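(* Let $N\ge 2$, $p\in[2,\infty[$ with $p>N$, $r_0>e$, $C_H=\left|\frac{p-N}{p}\right|^p$, $C_*=\frac{p-1}{2p}\left|\frac{p-N}{p}\right|^{p-2}$, $\varepsilon\in\,]0,C_*]$, and consider the equation $$-\Delta_p u-\frac{C_H}{|x|^p}|u|^{p-2}u-\frac{\varepsilon}{|x|^p\log^{2}|x|}|u|^{p-2}u=0\quad\text{in }B]r_0,\infty[.$$ Let $\beta_\varepsilon\le\bar\beta_\varepsilon$ be the real roots of $\frac12\left|\frac{p-N}{p}\right|^{p-2}(p-1)(2-\beta p)\beta=\varepsilon$. Then: (a) for every positive radial strictly monotone increasing $C^2$ strict supersolution $v$ of the equation and every $\tau<0$ there is $C>0$ with $$|x|^{\frac{p-N}{p}}(\log|x|)^{\beta_\varepsilon}(\log\log|x|)^\tau\le C\,v(x)\quad\text{for all }x\in B[r_0,\infty[;$$ (b) for every positive (not necessarily radial or increasing) $C^2$-supersolution $w$ of the equation, $$\limsup_{|x|\to\infty}\frac{|x|^{\frac{p-N}{p}}(\log|x|)^{\bar\beta_\varepsilon}(\log\log|x|)^\tau}{w(x)}>0$$ whenever either $\varepsilon<C_*$ and $\tau>0$, or $\varepsilon=C_*$ and $\tau>2/p$.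
   Context: $\Delta_p u=\nabla\cdot(|\nabla u|^{p-2}\nabla u)$. $B]r_0,\infty[=\{x\in\mathbb{R}^N:|x|>r_0\}$, $B[r_0,\infty[=\{x:|x|\ge r_0\}$. A $C^2$-supersolution is a function $w\in C^2(B[r_0,\infty[)$ for which the left-hand side of the equation evaluated at $w$ is $\ge 0$ pointwise in $B]r_0,\infty[$; a strict supersolution has $>0$ at every point. A radial function $v(x)=\phi(|x|)$ is strictly monotone increasing if $\phi'(r)>0$ for all $r\ge r_0$. (For $0<\varepsilon<C_*$ one has $0<\beta_\varepsilon<\frac1p<\bar\beta_\varepsilon<\frac2p$, and for $\varepsilon=C_*$, $\beta_\varepsilon=\bar\beta_\varepsilon=\frac1p$.) *)

(* Defs.v *)
From HB Require Import structures.
From mathcomp Require Import all_boot all_order all_algebra.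
From mathcomp Require Import all_classical all_reals all_analysis.
Set Implicit Arguments. Unset Strict Implicit. Unset Printing Implicit Defensive.
Import Order.TTheory GRing.Theory Num.Theory.
Import numFieldNormedType.Exports.
Local Open Scope ring_scope.

Section Defs.
Variables (R : realType) (N : nat).
Local Notation V := 'rV[R]_N.

(* Euclidean norm |x| (the library norm on matrices is the sup norm). *)
Definition enorm (x : V) : R := Num.sqrt (\sum_(i < N) (x 0 i) ^+ 2).

Definition evec (i : 'I_N) : V := delta_mx 0 i.
Definition partial (i : 'I_N) (f : V -> R) (x : V) : R := derive f x (evec i).

Definition gradnorm (u : V -> R) (x : V) : R :=
  Num.sqrt (\sum_(i < N) (partial i u x) ^+ 2).

Definition pLaplacian (p : R) (u : V -> R) (x : V) : R :=
  \sum_(i < N) partial i (fun y => gradnorm u y `^ (p - 2) * partial i u y) x.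

Definition C2_on_ext (r1 : R) (u : V -> R) : Prop :=
  forall x : V, r1 < enorm x ->
    {for x, continuous u} /\
    forall i j : 'I_N,
      derivable u x (evec i) /\ derivable (partial i u) x (evec j) /\
      {for x, continuous (partial i u)} /\
      {for x, continuous (partial j (partial i u))}.

(* u in C^2(B[r0,oo[): u is C^2 on an open neighbourhood of the closed set
   B[r0,oo[, equivalently on some B]r1,oo[ with r1 < r0. *)
Definition C2_closed_ext (r0 : R) (u : V -> R) : Prop :=
  exists r1 : R, r1 < r0 /\ C2_on_ext r1 u.

Definition eqLHS (p CH eps : R) (u : V -> R) (x : V) : R :=
  - pLaplacian p u x
  - CH / (enorm x `^ p) * (`|u x| `^ (p - 2) * u x)
  - eps / (enorm x `^ p * (ln (enorm x)) ^+ 2) * (`|u x| `^ (p - 2) * u x).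

Definition C2_supersolution (p CH eps r0 : R) (w : V -> R) : Prop :=
  C2_closed_ext r0 w /\ forall x : V, r0 < enorm x -> 0 <= eqLHS p CH eps w x.

Definition C2_strict_supersolution (p CH eps r0 : R) (w : V -> R) : Prop :=
  C2_closed_ext r0 w /\ forall x : V, r0 < enorm x -> 0 < eqLHS p CH eps w x.

Definition radial_strictly_increasing (r0 : R) (v : V -> R) : Prop :=
  exists phi : R -> R,
    (forall x : V, r0 <= enorm x -> v x = phi (enorm x)) /\
    (forall r : R, r0 <= r -> derivable phi r 1 /\ 0 < derive1 phi r).

Definition profile (p beta tau : R) (x : V) : R :=
  enorm x `^ ((p - N%:R) / p) * ln (enorm x) `^ beta * ln (ln (enorm x)) `^ tau.

End Defs.

(* Main.v *)
(** Write kappa = (p - N) / p and s = ln |x|.  If a C^2 supersolution [w] lies above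
    the radial function [exp (l (ln |x|))] near a point and touches it there, then comparing
    gradients and second derivatives at that point gives, for y = l', the Riccati inequality
    (p - 1) y^(p-2) (y^2 + y') - p kappa y^(p-1) + kappa^p + eps / s^2 <= 0.  With
    y = kappa + h / s it reads s h' <= - p/2 (h - beta) (h - betabar) + O(1/s).

    (a) A radial supersolution touches itself, so its own [h] satisfies this for all large [s];
    as h > 0, [beta - h] cannot persist above a multiple of s^(-1/2), and integrating [y]
    gives |x|^kappa (ln |x|)^beta <= C v(x), even without the log-log factor.

    (b) Explicit functions violating the Riccati inequality are never touched by [w].  One,
    |x|^kappa (s - ln r0), vanishes on the inner sphere; the other starts with h = betabar + 1
    at a far radius and then lies below the given profile.  If profile / w tended to 0, then
    the larger of the maxima of (suitable multiple of the first) / w and (second) / w over two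
    overlapping annuli would be attained in the interior, which is impossible. *)

Require Import Defs.
From HB Require Import structures.
From mathcomp Require Import all_boot all_order all_algebra.
From mathcomp Require Import all_classical all_reals all_analysis.
From mathcomp Require Import ring lra.
Set Implicit Arguments. Unset Strict Implicit. Unset Printing Implicit Defensive.
Import Order.TTheory GRing.Theory Num.Theory.
Import numFieldNormedType.Exports.
Local Open Scope ring_scope.
Local Open Scope classical_set_scope.

(** * One-variable calculus *)

Lemma is_derive_continuous (R : realType) (f : R -> R) (x d : R) :
  is_derive x 1 f d -> {for x, continuous f}.
Proof. by move=> [/derivable1_diffP fx _]; exact: differentiable_continuous. Qed.

Lemma MVT_closed (R : realType) (f df : R -> R) (a b : R) : a < b ->
  (forall x, a <= x <= b -> is_derive x 1 f (df x)) ->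
  exists2 c, a < c < b & f b - f a = df c * (b - a).
Proof.
move=> ab fdf; have [||c + ->] := @MVT R f df a b ab; last first.
- by rewrite in_itv /= => cab; exists c.
- apply: continuous_in_subspaceT => x; rewrite inE /= in_itv /= => xab.
  exact: is_derive_continuous (fdf x xab).
- by move=> x; rewrite in_itv /= => /andP[ax xb]; apply: fdf; rewrite !ltW.
Qed.

Lemma derive_ge0_le (R : realType) (f df : R -> R) (a b : R) : a <= b ->
  (forall x, a <= x <= b -> is_derive x 1 f (df x)) ->
  (forall x, a <= x <= b -> 0 <= df x) -> f a <= f b.
Proof.
rewrite le_eqVlt => /predU1P[-> //|ab] fdf df0.
have [c /andP[ac cb] e] := MVT_closed ab fdf.
by rewrite -subr_ge0 e mulr_ge0 ?subr_ge0 ?(ltW ab)// df0// !ltW.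
Qed.

Lemma derive_gt0_lt (R : realType) (f df : R -> R) (a b : R) : a < b ->
  (forall x, a <= x <= b -> is_derive x 1 f (df x)) ->
  (forall x, a <= x <= b -> 0 < df x) -> f a < f b.
Proof.
move=> ab fdf df0; have [c /andP[ac cb] e] := MVT_closed ab fdf.
by rewrite -subr_gt0 e mulr_gt0 ?subr_gt0// df0// !ltW.
Qed.

Lemma is_derive_gt0_right (R : realType) (f : R -> R) (a d : R) : is_derive a 1 f d -> 0 < d ->
  exists2 e, 0 < e & forall h, 0 < h < e -> f a < f (a + h).
Proof.
move=> [df /esym dE] d0.
have /cvgrPdist_lt/(_ d d0)[e /= e0 eP] :
    (fun h : R => h^-1 *: ((f \o shift a) (h *: 1) - f a)) @ 0^' --> d by rewrite dE.
exists e => // h /andP[h0 he].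
have := eP h; rewrite /= sub0r normrN gtr0_norm// => /(_ he).
rewrite gt_eqF// => /(_ isT); rewrite [h%:A]mulr1 [h + a]addrC => /ltr_normlW.
by rewrite gtrBl /GRing.scale /= pmulr_rgt0 ?invr_gt0// subr_gt0.
Qed.

(** If [f2] were negative, [f1] would be negative just to the right of 0, and the mean value theorem
    would push [f] below [f 0] there. *)
Lemma second_derivative_test (R : realType) (f f1 : R -> R) (f2 e : R) : 0 < e ->
  (forall t : R, `|t| < e -> is_derive t 1 f (f1 t)) -> is_derive (0 : R) 1 f1 f2 ->
  (forall t, `|t| < e -> f 0 <= f t) -> f1 0 = 0 /\ 0 <= f2.
Proof.
move=> e0 ff1 f1f2 f0.
have inE' t : t \in `](- e), e[%R = (`|t| < e) by rewrite in_itv /= ltr_norml.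
have f10 : f1 0 = 0.
  have h0 : is_derive (0 : R) 1 f 0.
    apply: (@derive1_at_min R f (- e) e 0); rewrite ?inE' ?normr0//.
    - by lra.
    - by move=> t; rewrite inE' => /ff1[].
    - by move=> t; rewrite inE' => /f0.
  have [_ <-] := ff1 0 ltac:(by rewrite normr0).
  by have [_ ->] := h0.
split => //; rewrite leNgt; apply/negP => f20.
have [|d d0 dP] := is_derive_gt0_right (is_deriveN f1f2); first by rewrite oppr_gt0.
have {}dP h : 0 < h -> h < d -> f1 h < 0.
  by move=> h0 hd; have := dP h; rewrite h0 hd add0r => /(_ isT); rewrite ltrN2 f10.
pose h := Num.min d e / 2.
have hm : 0 < Num.min d e by rewrite lt_min d0.
have h0 : 0 < h by rewrite divr_gt0.
have hd : h < Num.min d e by rewrite ltr_pdivrMr// ltr_pMr// ltr1n.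
have /andP[hd' he] : (h < d) && (h < e) by rewrite -lt_min.
have [|c /andP[c0 ch] ec] := @MVT_closed R f f1 0 h h0.
  by move=> x /andP[x0 xh]; apply: ff1; rewrite ger0_norm// (le_lt_trans xh).
have : f 0 <= f h by apply: f0; rewrite gtr0_norm.
apply/negP; rewrite -ltNge -subr_lt0 ec subr0 nmulr_rlt0// dP//.
exact: lt_trans hd'.
Qed.

Lemma is_derive_line (R : realType) (N : nat) (f : 'rV[R]_N -> R) (x v : 'rV[R]_N) (t d : R) :
  is_derive (x + t *: v) v f d <-> is_derive t 1 (fun s => f (x + s *: v)) d.
Proof.
have E : (fun h : R => h^-1 *: ((f \o shift (x + t *: v)) (h *: v) - f (x + t *: v))) =
  (fun h : R => h^-1 *: (((fun s => f (x + s *: v)) \o shift t) (h *: 1) - f (x + t *: v))).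
  by apply/funext => h /=; rewrite [h%:A]mulr1 scalerDl addrCA.
by split => -[h1 h2]; apply: DeriveDef; move: h1 h2; rewrite /derivable /derive E.
Qed.

Lemma is_derive_mulr (R : realType) (c s : R) : is_derive s 1 ( *%R^~ c) c.
Proof.
have h := @is_deriveM R R id (cst c) s 1 1 0 (is_derive_id _ _) (is_derive_cst _ _ _).
by apply: is_derive_eq h _; rewrite scaler0 add0r [c%:A]mulr1.
Qed.

(** * Directional derivatives of C^1 functions *)

(** The increment [h *: v] is made one coordinate at a time; the mean value theorem applies on each
    segment, and continuity of the partial derivatives at [x] replaces their intermediate values by
    those at [x]. Derivatives in non-axis directions, such as the radial one, come from here. *)
Lemma is_derive_C1 (R : realType) (N : nat) (f : 'rV[R]_N -> R) (x v : 'rV[R]_N) :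
  (\forall y \near x, forall i, derivable f y (evec R i)) ->
  (forall i, {for x, continuous (partial i f)}) ->
  is_derive x v f (\sum_(i < N) v 0 i * partial i f x).
Proof.
move=> df cf; set L := \sum_(i < N) _.
suff cvgL : (fun h : R => h^-1 *: ((f \o shift x) (h *: v) - f x)) @ 0^' --> L.
  by apply: DeriveDef; [apply/cvg_ex; exists L | exact/cvg_lim].
pose trunc k : 'rV[R]_N := \row_j (if (j < k)%N then v 0 j else 0).
have truncS (k : 'I_N) : trunc k.+1 = trunc k + v 0 k *: evec R k.
  apply/rowP => j; rewrite !mxE eqxx /= ltnS leq_eqVlt.
  have [<-|jk] := eqVneq j k; first by rewrite eqxx ltnn /= mulr1 add0r.
  by rewrite (negPf jk : (val j == val k) = false) /= mulr0 addr0.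
apply/cvgrPdist_le => /= e e0.
(* The added 1 keeps [S] positive when [v] vanishes; with tolerance [e / S] the errors on the
   segments sum to at most [|h| * e]. *)
pose S := \sum_(i < N) `|v 0 i| + 1.
have S0 : 0 < S by rewrite ltr_wpDl// sumr_ge0.
pose e' := e / S.
have e'0 : 0 < e' by rewrite divr_gt0.
have : \forall y \near x, (forall i, derivable f y (evec R i)) /\
    forall i, `|partial i f x - partial i f y| <= e'.
  apply: filterI => //.
  apply: (@filter_forall _ _ (fun i y => `|partial i f x - partial i f y| <= e') (nbhs x) (nbhs_filter x)) => i.
  by have /cvgrPdist_le/(_ _ e'0) := cf i.
move=> /nbhs_normP[d /= d0 dP].
have v0 : 0 < `|v| + 1 by rewrite ltr_wpDl.
near=> h.
have h0 : h != 0 by near: h; exact: nbhs_dnbhs_neq.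
have hd : `|h| * (`|v| + 1) < d.
  rewrite -ltr_pdivlMr//; near: h; apply: (@dnbhs0_lt R R); exact: divr_gt0.
have inball (k : 'I_N) (s : R) : 0 <= s <= 1 ->
    `|x - (x + h *: trunc k + (s * (h * v 0 k)) *: evec R k)| < d.
  move=> /andP[s0 s1]; rewrite -addrA opprD addNKr normrN.
  apply: le_lt_trans hd.
  have -> : h *: trunc k + (s * (h * v 0 k)) *: evec R k =
     h *: \row_j (if (j < k)%N then v 0 j else if j == k then s * v 0 j else 0).
    apply/rowP => j; rewrite !mxE eqxx /=.
    have [->|jk] := eqVneq j k; first by rewrite ltnn /= mulr1n; ring.
    by rewrite /= mulr0n mulr0 addr0.
  rewrite normrZ ler_wpM2l// [leLHS]/Num.Def.normr /= mx_normrE.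
  apply: bigmax_le => [|[i j] _]; first by rewrite addr_ge0.
  rewrite mxE /= (@le_trans _ _ `|v|)// ?lerDl//.
  have vj : `|v 0 j| <= `|v|.
    rewrite [leRHS]/Num.Def.normr /= mx_normrE.
    exact: (@le_bigmax _ _ _ 0 (fun i => `|v i.1 i.2|) (0, j)).
  case: ifP => // _; case: ifP => _; last by rewrite normr0.
  by rewrite normrM ger0_norm// (le_trans _ vj)// ler_piMl.
have step (k : 'I_N) : `|f (x + h *: trunc k.+1) - f (x + h *: trunc k)
    - h * (v 0 k * partial k f x)| <= `|h| * `|v 0 k| * e'.
  (* Parametrising the segment by [0, 1] lets [h * v 0 k] have either sign or vanish. *)
  pose g (s : R) := f (x + h *: trunc k + (s * (h * v 0 k)) *: evec R k).
  pose z s := x + h *: trunc k + (s * (h * v 0 k)) *: evec R k.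
  have [|c /andP[c0 c1]] := @MVT_closed R g (fun s => h * v 0 k * partial k f (z s)) 0 1 ltr01.
    move=> s s01; rewrite mulrC.
    apply: (@is_derive1_comp _ (fun u => f (x + h *: trunc k + u *: evec R k)) (fun s => s * (h * v 0 k))).
      apply/is_derive_line.
      by have [/(_ k) dfz _] := dP _ (inball k s s01); exact: derivableP dfz.
    exact: is_derive_mulr.
  have -> : g 1 = f (x + h *: trunc k.+1).
    by rewrite /g truncS mul1r scalerDr addrA scalerA.
  have -> : g 0 = f (x + h *: trunc k) by rewrite /g mul0r scale0r addr0.
  rewrite subr0 mulr1 => ->.
  rewrite mulrA -mulrBr normrM distrC normrM ler_wpM2l ?mulr_ge0//.
  have [_ /(_ k)] := dP _ (inball k c ltac:(by rewrite !ltW)); exact.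
have -> : (f \o shift x) (h *: v) - f x =
   \sum_(k < N) (f (x + h *: trunc k.+1) - f (x + h *: trunc k)).
  rewrite -(big_mkord xpredT (fun k => f (x + h *: trunc k.+1) - f (x + h *: trunc k))).
  rewrite telescope_sumr// /=; congr (f _ - f _).
    rewrite addrC; congr (_ + _ *: _).
    by apply/rowP => j; rewrite mxE ltn_ord.
  by rewrite (_ : trunc 0%N = 0) ?scaler0 ?addr0//; apply/rowP => j; rewrite !mxE.
have -> : L = h^-1 *: \sum_(k < N) (h * (v 0 k * partial k f x)).
  by rewrite -mulr_sumr /GRing.scale /= mulKf.
rewrite -scalerBr -sumrB normrZ normfV ler_pdivrMl ?normr_gt0//.
rewrite (le_trans (ler_norm_sum _ _ _))//.
rewrite (@le_trans _ _ (\sum_(k < N) `|h| * `|v 0 k| * e'))//.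
  by apply: ler_sum => k _; rewrite distrC; exact: step.
rewrite -mulr_suml -mulr_sumr -mulrA ler_wpM2l// /e' mulrA ler_pdivrMr//.
by rewrite [leRHS]mulrC ler_wpM2r ?(ltW e0)// lerDl.
Unshelve. all: by end_near.
Qed.

(** * The Euclidean norm *)

Section EuclideanNorm.
Context {R : realType} {N : nat}.
Implicit Types x y v : 'rV[R]_N.

Lemma sumsq_ge0 (I : finType) (F : I -> R) : 0 <= \sum_i F i ^+ 2.
Proof. by apply: sumr_ge0 => i _; exact: sqr_ge0. Qed.

Lemma enorm_ge0 x : 0 <= enorm x.
Proof. exact: sqrtr_ge0. Qed.

Lemma enorm_sqr x : enorm x ^+ 2 = \sum_i x 0 i ^+ 2.
Proof. by rewrite sqr_sqrtr// sumsq_ge0. Qed.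

Lemma enorm_line x v t : enorm v = 1 ->
  enorm (x + t *: v) = Num.sqrt (enorm x ^+ 2 + 2 * (\sum_i x 0 i * v 0 i) * t + t ^+ 2).
Proof.
move=> v1; rewrite /enorm; congr Num.sqrt; rewrite -/(enorm x) enorm_sqr.
have -> : t ^+ 2 = t ^+ 2 * \sum_i v 0 i ^+ 2 by rewrite -enorm_sqr v1 expr1n mulr1.
rewrite 2!mulr_sumr mulr_suml -!big_split /=.
by apply: eq_bigr => i _; rewrite !mxE; ring.
Qed.

Lemma continuous_enorm : continuous (@enorm R N).
Proof.
move=> x; apply: (@continuous_comp _ _ _ (fun x => \sum_i x 0 i ^+ 2)); last exact: sqrt_continuous.
apply: continuous_big => [|i _ y]; first exact: add_continuous.
apply: (@continuous_comp _ _ _ (fun x : 'rV[R]_N => x 0 i) (fun z : R => z ^+ 2)).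
  exact: coord_continuous.
exact: exprn_continuous.
Qed.

Lemma near_lt_enorm r x : r < enorm x -> \forall y \near x, r < enorm y.
Proof. by move=> rx; exact: (cvgr_gt _ (@continuous_enorm x) _ rx). Qed.

Lemma continuous_line x v (t : R) : {for t, continuous (fun s : R => x + s *: v)}.
Proof. by apply: cvgD; [exact: cvg_cst | apply: cvgZr_tmp; exact: cvg_id]. Qed.

Lemma enorm_evec i : enorm (evec R i : 'rV[R]_N) = 1.
Proof.
rewrite /enorm (bigD1 i)//= big1 ?mxE ?eqxx ?addr0 ?expr1n ?sqrtr1// => j ji.
by rewrite mxE (negPf ji) /= expr0n.
Qed.

Lemma sum_evec (F : 'I_N -> R) i : \sum_j evec R i 0 j * F j = F i.
Proof.
rewrite (bigD1 i)//= big1 ?mxE ?eqxx ?mul1r ?addr0// => j ji.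
by rewrite mxE (negPf ji) /= mul0r.
Qed.

Lemma abs_coord_le_enorm x i : `|x 0 i| <= enorm x.
Proof.
rewrite -(ler_sqr (normr_ge0 _) (enorm_ge0 x))// ?nnegrE// real_normK ?num_real//.
by rewrite enorm_sqr (bigD1 i)//= lerDl sumr_ge0// => j _; exact: sqr_ge0.
Qed.

End EuclideanNorm.

(** * Directional derivatives of C^2 functions *)

Section C2.
Context {R : realType} {N : nat}.
Variables (r1 : R) (w : 'rV[R]_N -> R).
Hypothesis wC2 : C2_on_ext r1 w.

Lemma C2_is_derive x v : r1 < enorm x ->
  is_derive x v w (\sum_i v 0 i * partial i w x).
Proof.
move=> rx; apply: is_derive_C1 => [|i]; last by have [_ /(_ i i)[_ [_ []]]] := wC2 rx.
near=> y => i; have /wC2[_ /(_ i i)[]//] : r1 < enorm y.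
by near: y; exact: near_lt_enorm.
Unshelve. all: by end_near. Qed.

Lemma C2_is_derive_partial x v i : r1 < enorm x ->
  is_derive x v (partial i w) (\sum_j v 0 j * partial j (partial i w) x).
Proof.
move=> rx; apply: is_derive_C1 => [|j]; last by have [_ /(_ i j)[_ [_ []]]] := wC2 rx.
near=> y => j; have /wC2[_ /(_ i j)[_ []//]] : r1 < enorm y.
by near: y; exact: near_lt_enorm.
Unshelve. all: by end_near. Qed.

End C2.

(** * The p-Laplacian in nondivergence form *)

Lemma is_derive_line0 (R : realType) (N : nat) (f : 'rV[R]_N -> R) (x v : 'rV[R]_N) (d : R) :
  is_derive x v f d <-> is_derive (0 : R) 1 (fun s => f (x + s *: v)) d.
Proof. by rewrite -is_derive_line scale0r addr0. Qed.

Lemma is_derive_comp_dir (R : realType) (N : nat) (g : R -> R) (f : 'rV[R]_N -> R)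
    (x v : 'rV[R]_N) (d e : R) :
  is_derive x v f d -> is_derive (f x) 1 g e -> is_derive x v (g \o f) (e * d).
Proof.
move=> /is_derive_line0 df dg; apply/is_derive_line0.
apply: (@is_derive1_comp _ g (fun s => f (x + s *: v))) => //.
by rewrite scale0r addr0.
Qed.

Lemma is_derive_sum_fun (R : realType) (V : normedModType R) n (h : 'I_n -> V -> R)
    (x v : V) (dh : 'I_n -> R) : (forall i, is_derive x v (h i) (dh i)) ->
  is_derive x v (fun y => \sum_(i < n) h i y) (\sum_(i < n) dh i).
Proof. by move=> /is_derive_sum; rewrite fct_sumE. Qed.

Lemma gradnorm_powR (R : realType) (N : nat) (w : 'rV[R]_N -> R) (x : 'rV[R]_N) (q : R) :
  gradnorm w x `^ q = (\sum_i partial i w x ^+ 2) `^ (q / 2).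
Proof. by rewrite /gradnorm -powR12_sqrt ?sumsq_ge0// -powRrM mulrC. Qed.

(** The product rule, with the power of the gradient norm differentiated as a power of its square
    [P]. Positivity of [P] keeps away from critical points, where this power need not be smooth. *)
Lemma pLaplacian_nondivergence (R : realType) (N : nat) (r1 p : R) (w : 'rV[R]_N -> R)
    (x : 'rV[R]_N) : C2_on_ext r1 w -> r1 < enorm x ->
  let P := \sum_i partial i w x ^+ 2 in 0 < P ->
  pLaplacian p w x = P `^ ((p - 2) / 2) * (\sum_i partial i (partial i w) x
    + (p - 2) / P * \sum_i \sum_j partial i w x * partial j w x * partial i (partial j w) x).
Proof.
move=> wC2 rx P P0.
have dpart i j : is_derive x (evec R i) (partial j w) (partial i (partial j w) x).
  by apply: is_derive_eq (C2_is_derive_partial wC2 _ _ rx) _; rewrite sum_evec.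
have dsq i : is_derive x (evec R i) (fun y => \sum_j partial j w y ^+ 2)
    (2 * \sum_j partial j w x * partial i (partial j w) x).
  rewrite mulr_sumr; apply: is_derive_sum_fun => j.
  have h := @is_deriveX _ _ (partial j w) 2 x (evec R i) _ (dpart i j).
  apply: is_derive_eq h _.
  by rewrite expr1 /GRing.scale /=; ring.
have dpow i : is_derive x (evec R i) (fun y => gradnorm w y `^ (p - 2))
    ((p - 2) / P * P `^ ((p - 2) / 2) * \sum_j partial j w x * partial i (partial j w) x).
  rewrite (_ : (fun y => _) =
      (fun z : R => z `^ ((p - 2) / 2)) \o (fun y => \sum_j partial j w y ^+ 2)); last first.
    by apply/funext => y /=; rewrite gradnorm_powR.
  apply: is_derive_eq (is_derive_comp_dir (dsq i) (is_derive1_powR _ P0)) _.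
  rewrite powRB ?P0 ?(gt_eqF P0) ?implybT// powRr1 ?ltW//.
  by field; rewrite gt_eqF.
have dterm i : partial i (fun y => gradnorm w y `^ (p - 2) * partial i w y) x =
    P `^ ((p - 2) / 2) * partial i (partial i w) x + P `^ ((p - 2) / 2) * ((p - 2) / P) *
    \sum_j partial i w x * partial j w x * partial i (partial j w) x.
  have [_] := @is_deriveM _ _ _ _ x (evec R i) _ _ (dpow i) (dpart i i).
  rewrite -[X in X = _]/(partial i (fun y => gradnorm w y `^ (p - 2) * partial i w y) x) => ->.
  rewrite /GRing.scale /= gradnorm_powR -/P; congr (_ + _).
  rewrite mulrCA !mulr_sumr; apply: eq_bigr => j _; ring.
transitivity (\sum_i (P `^ ((p - 2) / 2) * partial i (partial i w) x +
    P `^ ((p - 2) / 2) * ((p - 2) / P) *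
    \sum_j partial i w x * partial j w x * partial i (partial j w) x)).
  by apply: eq_bigr => i _; exact: dterm.
rewrite big_split /= mulrDr; congr (_ + _); first by rewrite mulr_sumr.
by rewrite [RHS]mulrA [RHS]mulr_sumr.
Qed.

(** * Touching from below by a radial function *)

Lemma is_derive_Ml (R : realType) (V : normedModType R) (c : R) (f : V -> R) (x v : V) (d : R) :
  is_derive x v f d -> is_derive x v (fun y => c * f y) (c * d).
Proof. by move=> df; have := @is_deriveZ _ _ _ f c x v d df. Qed.

Lemma continuous_ln_enorm (R : realType) (N : nat) (x : 'rV[R]_N) : 0 < enorm x ->
  {for x, continuous (fun z => ln (enorm z))}.
Proof.
move=> x0; apply: (@continuous_comp _ _ _ (@enorm R N) (@ln R)).
  exact: continuous_enorm.
exact: continuous_ln.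
Qed.

Section Touching.
Context {R : realType} {N : nat}.
Variables (r1 : R) (w : 'rV[R]_N -> R) (x : 'rV[R]_N) (l l1 : R -> R) (l2 : R).
Hypothesis wC2 : C2_on_ext r1 w.
Hypothesis rx : r1 < enorm x.
Hypothesis x0 : 0 < enorm x.
Hypothesis dl : \forall s \near ln (enorm x), is_derive (s : R) 1 l (l1 s).
Hypothesis dl1 : is_derive (ln (enorm x)) 1 l1 l2.
Hypothesis below : \forall y \near x, expR (l (ln (enorm y))) <= w y.
Hypothesis touch : expR (l (ln (enorm x))) = w x.
Let r := enorm x.
Let y := l1 (ln r).

(** The right-hand sides are the first and second derivatives of [exp (l (ln |x + t v|))]
    at t = 0. *)
Lemma touching_line (v : 'rV[R]_N) : enorm v = 1 ->
  let a := \sum_i x 0 i * v 0 i in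
  \sum_i v 0 i * partial i w x = w x * y * a / r ^+ 2 /\
  w x * ((y ^+ 2 + l2) * a ^+ 2 / r ^+ 4 + y * (1 / r ^+ 2 - 2 * a ^+ 2 / r ^+ 4)) <=
  \sum_i v 0 i * \sum_j v 0 j * partial j (partial i w) x.
Proof.
move=> v1 a.
(* [q t] is |x + t v|^2, so [rho] is (ln q) / 2 and its derivative q' / (2 q) is [rho1]. *)
pose q t := r ^+ 2 + 2 * a * t + t ^+ 2.
pose rho (t : R) := ln (enorm (x + t *: v)).
pose rho1 t := (a + t) / q t.
have q0 : q 0 = r ^+ 2 by rewrite /q mulr0 addr0 expr0n addr0.
have qE t : enorm (x + t *: v) = Num.sqrt (q t) by rewrite enorm_line.
have rho0 : rho 0 = ln r by rewrite /rho scale0r addr0.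
have dq (t : R) : is_derive t 1 q (2 * (a + t)).
  rewrite /q; apply: is_derive_eq; rewrite /GRing.scale /=; ring.
have drho (t : R) : 0 < enorm (x + t *: v) -> is_derive t 1 rho (rho1 t).
  rewrite qE sqrtr_gt0 => qt.
  rewrite (_ : rho = @ln R \o (Num.sqrt \o q)); last by apply/funext => s; rewrite /rho qE.
  have sq : 0 < Num.sqrt (q t) by rewrite sqrtr_gt0.
  have h1 := is_derive1_comp (is_derive1_sqrt qt) (dq t).
  have h := @is_derive1_comp _ (@ln R) (Num.sqrt \o q) t _ _ (is_derive1_ln sq) h1.
  apply: is_derive_eq h _.
  rewrite /rho1 -{3}(sqr_sqrtr (ltW qt)); field; exact: lt0r_neq0.
(* [f] is the gap between [w] and the comparison function along the line; touching from below makes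
   0 a local minimum. [f1] is its derivative and [f2] its second derivative at 0. *)
pose f t := w (x + t *: v) - expR (l (rho t)).
pose f1 t := \sum_i v 0 i * partial i w (x + t *: v) - expR (l (rho t)) * (l1 (rho t) * rho1 t).
pose f2 := \sum_i v 0 i * (\sum_j v 0 j * partial j (partial i w) x) -
  w x * ((y ^+ 2 + l2) * a ^+ 2 / r ^+ 4 + y * (1 / r ^+ 2 - 2 * a ^+ 2 / r ^+ 4)).
have : \forall z \near x, [/\ r1 < enorm z, 0 < enorm z,
    is_derive (ln (enorm z)) 1 l (l1 (ln (enorm z))) & expR (l (ln (enorm z))) <= w z].
  have h1 := near_lt_enorm rx; have h2 := near_lt_enorm x0.
  have h3 : \forall z \near x, is_derive (ln (enorm z)) 1 l (l1 (ln (enorm z))).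
    exact: (continuous_ln_enorm x0 dl).
  by near=> z; split; near: z.
(* The base point becomes x + 0 v, so that continuity of the line at t = 0 pulls the neighbourhood
   of [x] back to one of 0. *)
rewrite -{1}[x](addr0 x) -{1}(scale0r v) => near_x.
have : \forall t \near (0 : R), [/\ r1 < enorm (x + t *: v), 0 < enorm (x + t *: v),
    is_derive (rho t) 1 l (l1 (rho t)) & expR (l (rho t)) <= w (x + t *: v)].
  exact: (@continuous_line R N x v 0 _ near_x).
move=> /nbhs_normP[e /= e0 eP].
have {}eP t : `|t| < e -> [/\ r1 < enorm (x + t *: v), 0 < enorm (x + t *: v),
    is_derive (rho t) 1 l (l1 (rho t)) & expR (l (rho t)) <= w (x + t *: v)].
  by move=> te; apply: eP; rewrite /= sub0r normrN.
have dexp (t : R) : `|t| < e -> is_derive t 1 (fun t => expR (l (rho t)))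
    (expR (l (rho t)) * (l1 (rho t) * rho1 t)).
  move=> /eP[_ et dt _].
  have h1 := @is_derive1_comp _ l rho t _ _ dt (drho _ et).
  exact: (@is_derive1_comp _ (@expR R) (l \o rho) t _ _ (is_derive_expR _) h1).
have [] := @second_derivative_test R f f1 f2 e e0.
- move=> t te; have [rt et dt _] := eP t te.
  have dw : is_derive t 1 (fun t => w (x + t *: v)) (\sum_i v 0 i * partial i w (x + t *: v)).
    by apply/is_derive_line; exact: (C2_is_derive wC2).
  exact: is_deriveB dw (dexp t te).
- rewrite /f1 /f2.
  have dpart : is_derive (0 : R) 1 (fun t => \sum_i v 0 i * partial i w (x + t *: v))
      (\sum_i v 0 i * (\sum_j v 0 j * partial j (partial i w) x)).
    apply: is_derive_sum_fun => i.
    apply: is_derive_Ml.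
    by apply/is_derive_line0; exact: (C2_is_derive_partial wC2).
  have e00 : `|0 : R| < e by rewrite normr0.
  have drho0 : is_derive (0 : R) 1 rho (rho1 0) by apply: drho; rewrite scale0r addr0.
  have dl1rho : is_derive (0 : R) 1 (l1 \o rho) (l2 * rho1 0).
    by apply: is_derive1_comp => //; rewrite rho0.
  have drho1 : is_derive (0 : R) 1 rho1 (1 / r ^+ 2 - 2 * a ^+ 2 / r ^+ 4).
    have q0n : q 0 != 0 by rewrite q0 expf_neq0// gt_eqF.
    have da := is_deriveD (is_derive_cst a (0 : R) 1) (is_derive_id (0 : R) 1).
    have h := is_deriveM da (is_deriveV q0n (dq 0)).
    apply: is_derive_eq h _.
    rewrite q0 -[(cst a + id) 0]/(a + 0) /GRing.scale /=; field; exact: lt0r_neq0.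
  have := is_deriveB dpart (is_deriveM (dexp 0 e00) (is_deriveM dl1rho drho1)).
  move=> h; apply: is_derive_eq h _; congr (_ - _).
  rewrite -[((l1 \o rho) * rho1) 0]/(l1 (rho 0) * rho1 0) /= rho0 touch /rho1 q0 -/y /GRing.scale /=; field; exact: lt0r_neq0.
- move=> t /eP[_ _ _]; rewrite -subr_ge0 -/(f t); apply: le_trans.
  by rewrite /f rho0 touch scale0r addr0 subrr.
rewrite /f1 /f2 rho0 touch scale0r addr0 -/y /rho1 q0 addr0 subr_ge0 => /subr0_eq -> ->.
by split=> //; rewrite !mulrA.
Unshelve. all: by end_near. Qed.

Lemma touching_gradient i : partial i w x = w x * y * x 0 i / r ^+ 2.
Proof.
have [+ _] := touching_line (enorm_evec i).
rewrite sum_evec => ->; congr (_ * _ / _).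
by rewrite -[RHS](sum_evec (fun j => x 0 j)); apply: eq_bigr => j _; rewrite mulrC.
Qed.

(** The second-order inequality is summed over the axes: the terms in x_i^2 add up to r^2 and the
    constant one occurs N times, whence the factor N - 2. *)
Lemma touching_laplacian :
  w x / r ^+ 2 * (y ^+ 2 + l2 + (N%:R - 2) * y) <= \sum_i partial i (partial i w) x.
Proof.
have r0 : r != 0 by rewrite gt_eqF.
pose c i := w x * ((y ^+ 2 + l2) * x 0 i ^+ 2 / r ^+ 4 + y * (1 / r ^+ 2 - 2 * x 0 i ^+ 2 / r ^+ 4)).
have -> : w x / r ^+ 2 * (y ^+ 2 + l2 + (N%:R - 2) * y) = \sum_i c i.
  pose A := w x * (y ^+ 2 + l2 - 2 * y) / r ^+ 4; pose B := w x * y / r ^+ 2.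
  transitivity (\sum_(i < N) (A * x 0 i ^+ 2 + B)).
    rewrite big_split /= -mulr_sumr -enorm_sqr sumr_const card_ord -mulr_natr -/r /A /B.
    by field.
  by apply: eq_bigr => i _; rewrite /A /B /c; field.
apply: ler_sum => i _; have [_] := touching_line (enorm_evec i).
rewrite sum_evec sum_evec; congr (_ <= _); rewrite /c.
rewrite (_ : \sum_j _ = x 0 i)//.
by rewrite -[RHS](sum_evec (fun j => x 0 j)); apply: eq_bigr => j _; rewrite mulrC.
Qed.

(** The second-order inequality in the unit direction x / r, where [a] equals [r]. *)
Lemma touching_radial : w x / r ^+ 2 * (y ^+ 2 + l2 - y) <=
  \sum_i \sum_j x 0 i / r * (x 0 j / r) * partial i (partial j w) x.
Proof.
have r0 : r != 0 by rewrite gt_eqF.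
have n1 : enorm (r^-1 *: x) = 1.
  rewrite /enorm (eq_bigr (fun i => r ^- 2 * x 0 i ^+ 2)); last first.
    by move=> i _; rewrite mxE exprMn exprVn.
  by rewrite -mulr_sumr -enorm_sqr -/r mulVf ?expf_neq0// sqrtr1.
have [_] := touching_line n1.
have -> : \sum_i x 0 i * (r^-1 *: x) 0 i = r.
  rewrite (eq_bigr (fun i => r^-1 * x 0 i ^+ 2)); last by move=> i _; rewrite mxE; ring.
  by rewrite -mulr_sumr -enorm_sqr -/r; field.
congr (_ <= _); first by field.
rewrite exchange_big /=; apply: eq_bigr => i _; rewrite mulr_sumr; apply: eq_bigr => j _.
by rewrite !mxE; ring.
Qed.

(** At the touching point the gradient is radial of length w y / r > 0. The nondivergence form is
    then the Laplacian plus p - 2 >= 0 times the second radial derivative, so the two preceding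
    lower bounds combine. *)
Lemma touching_pLaplacian (p : R) : 2 <= p -> 0 < y -> 0 < w x ->
  (w x * y / r) `^ (p - 2) * (w x / r ^+ 2 * ((p - 1) * (y ^+ 2 + l2) - (p - N%:R) * y))
    <= pLaplacian p w x.
Proof.
move=> p2 y0 w0; have r0 : 0 < r by [].
have PE : \sum_i partial i w x ^+ 2 = (w x * y / r) ^+ 2.
  rewrite (eq_bigr (fun i => (w x * y / r ^+ 2) ^+ 2 * x 0 i ^+ 2)); last first.
    by move=> i _; rewrite touching_gradient; ring.
  by rewrite -mulr_sumr -enorm_sqr -/r; field; rewrite gt_eqF.
have m0 : 0 < w x * y / r by rewrite divr_gt0// mulr_gt0.
rewrite (pLaplacian_nondivergence _ wC2 rx) PE ?exprn_gt0//.
have -> : ((w x * y / r) ^+ 2) `^ ((p - 2) / 2) = (w x * y / r) `^ (p - 2).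
  by rewrite -powR_mulrn ?(ltW m0)// -powRrM [2%:R * _]mulrC divfK.
rewrite ler_wpM2l ?powR_ge0//.
have -> : (p - 2) / (w x * y / r) ^+ 2 *
    (\sum_i \sum_j partial i w x * partial j w x * partial i (partial j w) x) =
    (p - 2) * \sum_i \sum_j x 0 i / r * (x 0 j / r) * partial i (partial j w) x.
  rewrite -mulrA; congr (_ * _); rewrite mulr_sumr; apply: eq_bigr => i _.
  rewrite mulr_sumr; apply: eq_bigr => j _; rewrite !touching_gradient.
  by field; rewrite !gt_eqF.
have -> : w x / r ^+ 2 * ((p - 1) * (y ^+ 2 + l2) - (p - N%:R) * y) =
  w x / r ^+ 2 * (y ^+ 2 + l2 + (N%:R - 2) * y) + (p - 2) * (w x / r ^+ 2 * (y ^+ 2 + l2 - y)).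
  by ring.
by rewrite lerD ?touching_laplacian// ler_wpM2l ?subr_ge0// touching_radial.
Qed.

(** All terms of the equation carry the common positive factor w^(p-1) / r^p, which is divided
    out. *)
Lemma touching_riccati (p CH eps : R) : 2 <= p -> 0 < y -> 0 < w x ->
  0 <= eqLHS p CH eps w x ->
  y `^ (p - 2) * ((p - 1) * (y ^+ 2 + l2) - (p - N%:R) * y) + CH + eps / ln r ^+ 2 <= 0.
Proof.
move=> p2 y0 w0; have r0 : 0 < r by [].
have := touching_pLaplacian p2 y0 w0; rewrite /eqLHS -/r gtr0_norm//.
have -> : (w x * y / r) `^ (p - 2) = w x `^ (p - 2) * y `^ (p - 2) / r `^ (p - 2).
  rewrite !powRM ?mulr_ge0 ?invr_ge0 ?(ltW r0) ?(ltW y0) ?(ltW w0)//.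
  by rewrite -powR_inv1 ?(ltW r0)// -powRrM mulN1r powRN.
have -> : r `^ p = r `^ (p - 2) * r ^+ 2.
  by rewrite -powR_mulrn ?(ltW r0)// -powRD ?subrK// (gt_eqF r0) implybT.
have A0 := powR_gt0 (p - 2) w0; have B0 := powR_gt0 (p - 2) r0.
move: (w x `^ _) (r `^ _) (y `^ _) A0 B0 => A B Y A0 B0 h1 h2.
have c0 : 0 < A * w x / (B * r ^+ 2) by rewrite divr_gt0// mulr_gt0// exprn_gt0.
rewrite -(pmulr_rle0 _ c0).
have -> : A * w x / (B * r ^+ 2) *
   (Y * ((p - 1) * (y ^+ 2 + l2) - (p - N%:R) * y) + CH + eps / ln r ^+ 2) =
   A * Y / B * (w x / r ^+ 2 * ((p - 1) * (y ^+ 2 + l2) - (p - N%:R) * y)) +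
   CH / (B * r ^+ 2) * (A * w x) + eps / (B * r ^+ 2 * ln r ^+ 2) * (A * w x).
  rewrite (invfM _ (ln r ^+ 2)); move: (ln r ^+ 2)^-1 => L.
  by field; rewrite !gt_eqF.
by move: h1 h2; lra.
Qed.

End Touching.

(** * The Riccati inequality *)

Section Riccati.
Context {R : realType}.
Implicit Types p kappa eps s y a b u x h k : R.

(** Minus the left-hand side of the equation at [exp (l (ln r))], divided by r^(-p) times the (p-1)-st power
    of the function, where y = l' and y' = l'' are taken at s = ln r. *)
Definition riccati p kappa eps s y y' : R :=
  y `^ (p - 2) * ((p - 1) * (y ^+ 2 + y') - p * kappa * y) + kappa `^ p + eps / s ^+ 2.

(** The tangent at 1 of a convex power, from exp t >= 1 + t and ln x <= x - 1. *)
Lemma powRN_ge_tangent x a : 0 < x -> 0 <= a -> 1 - a * (x - 1) <= x `^ (- a).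
Proof.
move=> x0 a0; rewrite /powR gt_eqF// (le_trans _ (expR_ge1Dx _))// lerD2l mulNr lerN2 ler_wpM2l//.
by rewrite -[in leLHS](subrKC 1 x) le_ln1Dx//; lra.
Qed.

Lemma is_derive_powR1D a u : 0 <= u ->
  is_derive u 1 (fun u => (1 + u) `^ a) (a * (1 + u) `^ (a - 1)).
Proof.
move=> u0; have u1 : 0 < 1 + u by rewrite ltr_wpDr.
have h := @is_derive1_comp _ (fun z : R => z `^ a) (cst (1 : R) + id) u _ _ (is_derive1_powR a u1)
  (is_deriveD (is_derive_cst (1 : R) u 1) (is_derive_id u 1)).
by apply: is_derive_eq h _; rewrite add0r mulr1.
Qed.

(** Differentiating the difference of the two sides reduces the bound to the tangent bound for the
    exponent b + 1. The third-order lower bound below follows from this one in the same way. *)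
Lemma powRN_le_taylor2 b u : 0 <= u -> 0 <= b ->
  (1 + u) `^ (- b) <= 1 - b * u + b * (b + 1) / 2 * u ^+ 2.
Proof.
move=> u0 b0.
pose f (t : R) := 1 - b * t + b * (b + 1) / 2 * t ^+ 2 - (1 + t) `^ (- b).
pose f1 (t : R) := - b + b * (b + 1) * t + b * (1 + t) `^ (- (b + 1)).
have : f 0 <= f u.
  apply: (@derive_ge0_le _ f f1 0 u u0) => t /andP[t0 _].
    have dP : is_derive t 1 (fun t => 1 - b * t + b * (b + 1) / 2 * t ^+ 2) (- b + b * (b + 1) * t).
      by apply: is_derive_eq; rewrite /GRing.scale /=; field.
    apply: is_derive_eq (is_deriveB dP (is_derive_powR1D (- b) t0)) _.
    rewrite /f1; have -> : - b - 1 = - (b + 1) by ring. by ring.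
  have b1 : 0 <= b + 1 by rewrite addr_ge0.
  have t1 : 0 < 1 + t by rewrite ltr_wpDr.
  have := ler_wpM2l b0 (powRN_ge_tangent t1 b1).
  rewrite /f1; lra.
by rewrite /f addr0 powR1 mulr0 expr0n /= mulr0 !(subr0, addr0) subrr subr_ge0.
Qed.

Lemma powRN_ge_taylor3 a u : 0 <= u -> 0 <= a ->
  1 - a * u + a * (a + 1) / 2 * u ^+ 2 - a * (a + 1) * (a + 2) / 6 * u ^+ 3 <= (1 + u) `^ (- a).
Proof.
move=> u0 a0.
pose P (t : R) := 1 - a * t + a * (a + 1) / 2 * t ^+ 2 - a * (a + 1) * (a + 2) / 6 * t ^+ 3.
pose f (t : R) := (1 + t) `^ (- a) - P t.
pose f1 (t : R) := - a * (1 + t) `^ (- (a + 1)) + a * (1 - (a + 1) * t + (a + 1) * (a + 2) / 2 * t ^+ 2).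
have : f 0 <= f u.
  apply: (@derive_ge0_le _ f f1 0 u u0) => t /andP[t0 _].
    have dP : is_derive t 1 P (- a + a * (a + 1) * t - a * (a + 1) * (a + 2) / 2 * t ^+ 2).
      by rewrite /P; apply: is_derive_eq; rewrite /GRing.scale /=; field.
    apply: is_derive_eq (is_deriveB (is_derive_powR1D (- a) t0) dP) _.
    rewrite /f1; have -> : - a - 1 = - (a + 1) by ring. by ring.
  have a1 : 0 <= a + 1 by rewrite addr_ge0.
  have := ler_wpM2l a0 (powRN_le_taylor2 t0 a1).
  rewrite /f1; lra.
by rewrite /f /P addr0 powR1 !mulr0 !expr0n /= !mulr0 !(subr0, addr0) subrr subr_ge0.
Qed.

(** Pulling out y^(p-2) leaves (y / kappa)^(-(p-2)) as the only non-polynomial dependence on [y],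
    ready for the preceding bounds around y = kappa. *)
Lemma riccati_factor p kappa eps s y y' : 0 < kappa -> 0 < y ->
  riccati p kappa eps s y y' =
  y `^ (p - 2) * ((p - 1) * (y ^+ 2 + y') - p * kappa * y +
    (kappa ^+ 2 + eps / kappa `^ (p - 2) / s ^+ 2) * (y / kappa) `^ (- (p - 2))).
Proof.
move=> k0 y0; rewrite /riccati.
have -> : kappa `^ p = kappa `^ (p - 2) * kappa ^+ 2.
  by rewrite -powR_mulrn ?(ltW k0)// -powRD ?subrK// (gt_eqF k0) implybT.
have yE : y `^ (p - 2) = (y / kappa) `^ (p - 2) * kappa `^ (p - 2).
  by rewrite -powRM ?divfK ?gt_eqF// ltW// divr_gt0.
rewrite powRN yE.
have A0 := powR_gt0 (p - 2) k0; have B0 : 0 < (y / kappa) `^ (p - 2) by rewrite powR_gt0// divr_gt0.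
move: (kappa `^ _) ((y / kappa) `^ _) (s ^+ 2)^-1 A0 B0 => A B L A0 B0.
by field; rewrite !gt_eqF.
Qed.

(** The tangent bound at y = kappa turns the bracket into (p - 1) (y' + (y - kappa)^2), and the
    [eps] term makes the inequality strict. Being global in [y], it precedes any knowledge that [y]
    is close to [kappa]. *)
Lemma riccati_le0_sqr p kappa eps s y y' : 2 <= p -> 0 < kappa -> 0 < y -> 0 < eps -> 0 < s ->
  riccati p kappa eps s y y' <= 0 -> y' + (y - kappa) ^+ 2 < 0.
Proof.
move=> p2 k0 y0 e0 s0; rewrite riccati_factor// pmulr_rle0 ?powR_gt0//.
have u0 : 0 < y / kappa by rewrite divr_gt0.
have p0 : 0 <= p - 2 by rewrite subr_ge0.
have := powRN_ge_tangent u0 p0.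
have V0 : 0 < (y / kappa) `^ (- (p - 2)) by rewrite powR_gt0.
have E0 : 0 < eps / kappa `^ (p - 2) / s ^+ 2 by rewrite !divr_gt0 ?powR_gt0 ?exprn_gt0.
move: (_ `^ _) (_ / s ^+ 2) V0 E0 => V E V0 E0 /(ler_wpM2l (sqr_ge0 kappa)).
have -> : kappa ^+ 2 * (1 - (p - 2) * (y / kappa - 1)) = kappa ^+ 2 - (p - 2) * kappa * (y - kappa).
  by field; rewrite gt_eqF.
move=> h1 h2; have h3 : 0 < E * V by rewrite mulr_gt0.
rewrite -(pmulr_rlt0 _ (_ : 0 < p - 1)); last by lra.
by rewrite mulrDl in h2; lra.
Qed.

(** In the expansion around [kappa] the constant and linear terms cancel and the quadratic ones add
    up to (p - 1) (p / 2) eta^2. The right-hand side collects the cubic remainder and the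
    first-order error in the [eps] term. *)
Lemma riccati_le0_taylor p kappa eps s eta y' : 2 <= p -> 0 < kappa -> 0 <= eta -> 0 < eps -> 0 < s ->
  let eps' := eps / ((p - 1) * kappa `^ (p - 2)) in
  riccati p kappa eps s (kappa + eta) y' <= 0 ->
  y' + p / 2 * eta ^+ 2 + eps' / s ^+ 2 <=
    (p * (p - 2) / (6 * kappa) + eps' * (p - 2) / kappa) * (eta ^+ 3 + eta / s ^+ 2).
Proof.
move=> p2 k0 n0 e0 s0 eps'; have p0 : 0 <= p - 2 by rewrite subr_ge0.
have p1 : 0 < p - 1 by lra.
rewrite riccati_factor ?ltr_wpDr// pmulr_rle0 ?powR_gt0 ?ltr_wpDr//.
have -> : eps / kappa `^ (p - 2) = (p - 1) * eps'.
  by rewrite /eps'; field; rewrite !gt_eqF ?powR_gt0.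
have E0 : 0 < eps' / s ^+ 2 by rewrite !divr_gt0 ?mulr_gt0 ?powR_gt0 ?exprn_gt0.
have eps0 : 0 < eps' by rewrite divr_gt0 ?mulr_gt0 ?powR_gt0.
have -> : (kappa + eta) / kappa = 1 + eta / kappa by rewrite mulrDl divff ?gt_eqF.
have u0 : 0 <= eta / kappa by rewrite divr_ge0// ltW.
have h1 := powRN_ge_taylor3 u0 p0.
have h2 : 1 - (p - 2) * (eta / kappa) <= (1 + eta / kappa) `^ (- (p - 2)).
  have := @powRN_ge_tangent (1 + eta / kappa) (p - 2).
  by rewrite ltr_wpDr// => /(_ isT p0); rewrite addrAC subrr add0r.
move: (_ `^ _) h1 h2 => V h1 h2 h3.
have {}h1 := ler_wpM2l (sqr_ge0 kappa) h1.
have {}h2 := ler_wpM2l (ltW E0) h2.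
have -> : (p * (p - 2) / (6 * kappa) + eps' * (p - 2) / kappa) * (eta ^+ 3 + eta / s ^+ 2) =
  p * (p - 2) / (6 * kappa) * eta ^+ 3 + eps' / s ^+ 2 * ((p - 2) * (eta / kappa)) +
  (p * (p - 2) / (6 * kappa) * (eta / s ^+ 2) + eps' * (p - 2) / kappa * eta ^+ 3).
  by field; rewrite !gt_eqF.
(* A single constant for both errors creates two cross terms, which are nonnegative. *)
have h4 : 0 <= p * (p - 2) / (6 * kappa) * (eta / s ^+ 2) + eps' * (p - 2) / kappa * eta ^+ 3.
  have pp : 0 <= p by lra.
  have k6 : 0 <= 6 * kappa by rewrite mulr_ge0// ltW.
  apply: addr_ge0; apply: mulr_ge0.
  - by apply: divr_ge0 => //; exact: mulr_ge0.
  - by apply: divr_ge0 => //; apply: exprn_ge0; exact: ltW.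
  - by apply: divr_ge0; [apply: mulr_ge0 => //|]; exact: ltW.
  - exact: exprn_ge0.
rewrite -subr_ge0 -(pmulr_rge0 _ p1).
move: h3; rewrite -[(p - 1) * eps' / _]mulrA; move: (eps' / s ^+ 2) E0 h2 h4 => E E0 h2 h4 h3.
have h5 : (p - 1) * (E * (1 - (p - 2) * (eta / kappa))) <= (p - 1) * (E * V) by rewrite ler_wpM2l ?(ltW p1).
have h6 := mulr_ge0 (ltW p1) h4.
have h7 : kappa ^+ 2 *
    (1 - (p - 2) * (eta / kappa) + (p - 2) * (p - 2 + 1) / 2 * (eta / kappa) ^+ 2
     - (p - 2) * (p - 2 + 1) * (p - 2 + 2) / 6 * (eta / kappa) ^+ 3) =
  kappa ^+ 2 - (p - 2) * kappa * eta + (p - 2) * (p - 1) / 2 * eta ^+ 2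
   - (p - 1) * (p * (p - 2) / (6 * kappa) * eta ^+ 3).
  by field; rewrite gt_eqF.
rewrite h7 in h1.
move: h1 h5 h6 h3; lra.
Qed.

(** For y = kappa + h / s and k = s h', the derivative y' is (k - h) / s^2. After multiplication by
    s^2 the quadratic (p / 2) h^2 - h + eps' appears, and its roots are [beta] and [betabar]. *)
Lemma riccati_le0_rescaled p kappa eps beta betabar : 2 <= p -> 0 < kappa -> 0 < eps ->
  beta + betabar = 2 / p -> beta * betabar = 2 / p * (eps / ((p - 1) * kappa `^ (p - 2))) ->
  exists2 K, 0 <= K & forall s h k, 0 < s -> 0 <= h ->
    riccati p kappa eps s (kappa + h / s) ((k - h) / s ^+ 2) <= 0 ->
    k + p / 2 * (h - beta) * (h - betabar) <= K * (h ^+ 3 + h) / s.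
Proof.
move=> p2 k0 e0 sumb prodb; set eps' := eps / _ in prodb.
have p1 : 0 < p - 1 by lra.
have eps0 : 0 < eps' by rewrite divr_gt0 ?mulr_gt0 ?powR_gt0.
exists (p * (p - 2) / (6 * kappa) + eps' * (p - 2) / kappa).
  have pp : 0 <= p by lra.
  have p0 : 0 <= p - 2 by rewrite subr_ge0.
  have k6 : 0 <= 6 * kappa by rewrite mulr_ge0// ltW.
  apply: addr_ge0; first by apply: divr_ge0 => //; exact: mulr_ge0.
  by apply: divr_ge0; [apply: mulr_ge0 => //|]; exact: ltW.
move=> s h k s0 h0 /(riccati_le0_taylor p2 k0 (divr_ge0 h0 (ltW s0)) e0 s0).
rewrite -/eps'; set K := p * (p - 2) / (6 * kappa) + eps' * (p - 2) / kappa => H.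
have s2 : 0 < s ^+ 2 by rewrite exprn_gt0.
have := ler_wpM2l (ltW s2) H.
have -> : s ^+ 2 * (K * ((h / s) ^+ 3 + h / s / s ^+ 2)) = K * (h ^+ 3 + h) / s by field; rewrite gt_eqF.
apply: le_trans; rewrite le_eqVlt; apply/orP; left; apply/eqP.
have -> : p / 2 * (h - beta) * (h - betabar) =
   p / 2 * h ^+ 2 - p / 2 * h * (beta + betabar) + p / 2 * (beta * betabar) by ring.
rewrite sumb prodb; field; rewrite !gt_eqF//; lra.
Qed.

End Riccati.

(** * Growth of radial supersolutions *)

(** Past the last point where [f] is nonnegative, continuity keeps [f] above [- m] for a while, so
    [f] would increase and stay nonnegative. The margin [m] makes the derivative available on that
    stretch. *)
Lemma derive_barrier (R : realType) (f f1 : R -> R) (a b m : R) : a <= b -> 0 < m ->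
  (forall s, a <= s <= b -> is_derive s 1 f (f1 s)) ->
  (forall s, a <= s <= b -> - m <= f s -> 0 < f1 s) -> 0 <= f a -> 0 <= f b.
Proof.
move=> ab m0 df f1_gt0 fa; rewrite leNgt; apply/negP => fb.
pose A := [set s | a <= s <= b /\ 0 <= f s].
have Aa : A a by rewrite /A /= lexx ab.
have supA : has_sup A by split; [exists a | exists b => s [/andP[]]].
have ac : a <= sup A by exact: sup_upper_bound.
have cb : sup A <= b by apply: ge_sup => [|s [/andP[]]//]; exists a.
have cf : {for sup A, continuous f} by apply: is_derive_continuous (df _ _); rewrite ac cb.
have fc : 0 <= f (sup A).
  rewrite leNgt; apply/negP => fc.
  have /nbhs_normP[e /= e0 eP] : \forall s \near sup A, f s < 0 by exact: (cvgr_lt _ cf _ fc).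
  have [s As es] := sup_adherent e0 supA.
  have sc := sup_upper_bound supA As.
  have /eP : `|sup A - s| < e by rewrite ger0_norm ?subr_ge0// ltrBlDr -ltrBlDl.
  by rewrite ltNge; case: As => _ ->.
have {}cb : sup A < b.
  rewrite lt_neqAle cb andbT; apply/eqP => cE; move: fc; rewrite cE leNgt fb //.
have /nbhs_normP[e /= e0 eP] : \forall s \near sup A, - m < f s.
  by apply: (cvgr_gt _ cf); rewrite (lt_le_trans _ fc)// oppr_lt0.
pose d := Num.min (e / 2) (b - sup A).
have d0 : 0 < d by rewrite lt_min divr_gt0// subr_gt0.
have de : d < e by rewrite gt_min ltr_pdivrMr// ltr_pMr// ltr1n.
have db : sup A + d <= b by rewrite -lerBrDl ge_min lexx orbT.
have inab s : sup A <= s <= sup A + d -> a <= s <= b.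
  by move=> /andP[s1 s2]; rewrite (le_trans ac s1) (le_trans s2 db).
have : f (sup A) < f (sup A + d).
  apply: (@derive_gt0_lt _ f f1); first by rewrite ltrDl.
    by move=> s /inab; exact: df.
  move=> s sd; apply: f1_gt0; first exact: inab.
  apply/ltW/eP; case/andP: sd => s1 s2.
  by rewrite /= distrC ger0_norm ?subr_ge0// (le_lt_trans _ de)// lerBlDl.
move=> /ltW /(le_trans fc) fd.
have : sup A + d <= sup A.
  by apply: sup_upper_bound => //; split=> //; rewrite inab// lexx lerDl ltW.
by rewrite gerDl leNgt d0.
Qed.

Section SupersolutionGrowth.
Context {R : realType}.
Variables (p kappa eps beta betabar s0 : R) (l y y1 : R -> R).
Hypotheses (p2 : 2 <= p) (kappa0 : 0 < kappa) (eps0 : 0 < eps) (s0_gt0 : 0 < s0).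
Hypotheses (beta0 : 0 < beta) (beta_le : beta <= betabar).
Hypothesis sumb : beta + betabar = 2 / p.
Hypothesis prodb : beta * betabar = 2 / p * (eps / ((p - 1) * kappa `^ (p - 2))).
Hypothesis dl : forall s, s0 < s -> is_derive s 1 l (y s).
Hypothesis dy : forall s, s0 < s -> is_derive s 1 y (y1 s).
Hypothesis y_gt0 : forall s, s0 < s -> 0 < y s.
Hypothesis ric : forall s, s0 < s -> riccati p kappa eps s (y s) (y1 s) <= 0.

Let y1_lt s : s0 < s -> y1 s + (y s - kappa) ^+ 2 < 0.
Proof.
move=> ss; apply: riccati_le0_sqr p2 kappa0 (y_gt0 ss) eps0 _ (ric ss).
exact: lt_trans ss.
Qed.

Let dyk s : s0 < s -> is_derive s 1 (fun t => y t - kappa) (y1 s).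
Proof. by move=> /dy ds; have := is_deriveB ds (is_derive_cst kappa s 1); rewrite subr0. Qed.

(** Since y' < - (y - kappa)^2, [y] decreases; once below [kappa] it would fall at a rate bounded
    away from 0 and lose its positivity in finite time. *)
Lemma riccati_gt_kappa s : s0 < s -> kappa < y s.
Proof.
move=> ss; rewrite ltNge; apply/negP => yk.
have y_decr a b : s0 < a -> a < b -> y b < y a.
  move=> sa ab; rewrite -ltrN2.
  apply: (@derive_gt0_lt _ (- y) (- y1)) => // t /andP[ta _].
    by apply: is_deriveN; apply: dy; exact: lt_le_trans ta.
  have := y1_lt (lt_le_trans sa ta); rewrite -[(- y1) t]/(- y1 t).
  have := sqr_ge0 (y t - kappa); lra.
have yk1 : y (s + 1) < kappa by apply: lt_le_trans yk; apply: y_decr => //; lra.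
pose d := (kappa - y (s + 1)) ^+ 2.
have d0 : 0 < d by rewrite exprn_gt0// subr_gt0.
have s1 : s0 < s + 1 by lra.
(* At [b] the line of slope [- d] issuing from [y (s + 1)] reaches 0. *)
pose b := s + 1 + y (s + 1) / d.
have sb : s + 1 < b by rewrite ltrDl divr_gt0// y_gt0.
have : - y (s + 1) - d * (s + 1) <= - y b - d * b.
  apply: (@derive_ge0_le _ (fun t => - y t - d * t) (fun t => - y1 t - d)) => [|t /andP[ta _]|t /andP[ta _]].
  - exact: ltW.
  - have := is_deriveB (is_deriveN (dy (lt_le_trans s1 ta))) (is_derive_Ml d (is_derive_id t 1)).
    by rewrite mulr1.
  - have yt : y t <= y (s + 1).
      by move: ta; rewrite le_eqVlt => /predU1P[->//|/(y_decr _ _ s1)/ltW].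
    have := y1_lt (lt_le_trans s1 ta).
    have : d <= (y t - kappa) ^+ 2.
      rewrite /d -[leRHS]sqrrN opprB ler_sqr ?nnegrE ?subr_ge0; lra.
    lra.
have -> : d * b = d * (s + 1) + y (s + 1) by rewrite /b; field; rewrite gt_eqF.
have := y_gt0 (lt_trans s1 sb); lra.
Qed.

(** The reciprocal of y - kappa has derivative at least 1, so it exceeds s - (s0 + 1), which is at
    least s / 2 in the given range. *)
Lemma riccati_excess_le s : 2 * (s0 + 1) <= s -> s * (y s - kappa) <= 2.
Proof.
move=> ss; pose sa := s0 + 1.
have sa0 : s0 < sa by rewrite ltrDl.
have sas : sa < s by rewrite /sa; move: s0_gt0; lra.
have : (y sa - kappa)^-1 - sa <= (y s - kappa)^-1 - s.
  apply: (@derive_ge0_le _ (fun t => (y t - kappa)^-1 - t)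
     (fun t => - (y t - kappa) ^- 2 * y1 t - 1)) => [|t /andP[ta _]|t /andP[ta _]].
  - exact: ltW.
  - have ts := lt_le_trans sa0 ta.
    have yn0 : y t - kappa != 0 by rewrite gt_eqF// subr_gt0 riccati_gt_kappa.
    exact: is_deriveB (@is_deriveV _ (fun t => y t - kappa) t _ _ yn0 (dyk ts)) (is_derive_id t 1).
  - have ts := lt_le_trans sa0 ta.
    have e2 : 0 < (y t - kappa) ^+ 2 by rewrite exprn_gt0// subr_gt0 riccati_gt_kappa.
    rewrite subr_ge0 mulNr mulrC -mulNr ler_pdivlMr// mul1r.
    have := y1_lt ts; lra.
have e1 : 0 < y s - kappa by rewrite subr_gt0 riccati_gt_kappa// (lt_trans sa0).
have e2 : 0 < (y sa - kappa)^-1 by rewrite invr_gt0 subr_gt0 riccati_gt_kappa.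
move=> h; have : s / 2 <= (y s - kappa)^-1 by rewrite /sa in h e2 *; lra.
by rewrite -(ler_pM2r e1) mulVf ?gt_eqF// => h2; lra.
Qed.

(** The deficit k = beta - h, with h = s (y - kappa), satisfies s k' >= (p / 2) k^2 - O(1/s) where k
    >= 0. If k^2 exceeded a multiple of 1/s, then [k] would grow at least logarithmically, against k
    < beta. The exponent -3/2 is this s^(-1/2) bound divided by [s]. *)
Lemma riccati_excess_ge : exists2 C, 0 <= C & forall s, 2 * (s0 + 1) <= s ->
  kappa + beta / s - C * s `^ (- 2^-1 - 1) <= y s.
Proof.
have [K K0 KP] := riccati_le0_rescaled p2 kappa0 eps0 sumb prodb.
have p0 : 0 < p by exact: lt_le_trans p2.
(* 10 is 2^3 + 2, from h <= 2 in h^3 + h; the added 1 makes [K1] positive. *)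
pose K1 := 10 * K + 1.
have K10 : 0 < K1 by rewrite /K1; lra.
pose k s := beta - s * (y s - kappa).
pose k1 s := - (s * y1 s + (y s - kappa)).
have dk s : s0 < s -> is_derive s 1 k (k1 s).
  move=> ss; have h := is_deriveM (is_derive_id s 1) (dyk ss).
  apply: is_derive_eq (is_deriveB (is_derive_cst beta s 1) h) _.
  by rewrite sub0r /k1 /GRing.scale /= mulr1.
have k_lt s : s0 < s -> k s < beta.
  move=> ss; rewrite /k gtrBl mulr_gt0 ?subr_gt0 ?riccati_gt_kappa//; exact: lt_trans ss.
have k1_ge s : 2 * (s0 + 1) <= s -> 0 <= k s -> p / 2 * k s ^+ 2 - 10 * K / s <= s * k1 s.
  move=> ss ks; have s_gt : s0 < s by move: s0_gt0; lra.
  have s_gt0 := lt_trans s0_gt0 s_gt.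
  have h0 : 0 <= s * (y s - kappa) by rewrite mulr_ge0 ?subr_ge0 ?ltW// riccati_gt_kappa.
  have := KP s (s * (y s - kappa)) (s * (s * y1 s + (y s - kappa))) s_gt0 h0.
  have -> : kappa + s * (y s - kappa) / s = y s by field; rewrite gt_eqF.
  have -> : (s * (s * y1 s + (y s - kappa)) - s * (y s - kappa)) / s ^+ 2 = y1 s by field; rewrite gt_eqF.
  move=> /(_ (ric s_gt)).
  have h2 := riccati_excess_le ss.
  have : K * ((s * (y s - kappa)) ^+ 3 + s * (y s - kappa)) / s <= 10 * K / s.
    rewrite ler_pM2r ?invr_gt0// mulrC ler_wpM2r//.
    have : (s * (y s - kappa)) ^+ 3 <= 2 ^+ 3 by rewrite lerXn2r ?nnegrE.
    lra.
  have -> : s * (y s - kappa) = beta - k s by rewrite /k; ring.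
  have -> : s * (s * y1 s + (y s - kappa)) = - (s * k1 s) by rewrite /k1; ring.
  have : 0 <= k s * (betabar - beta) by apply: mulr_ge0 => //; rewrite subr_ge0.
  move=> /(ler_wpM2l (_ : 0 <= p / 2)); rewrite mulr0 => /(_ ltac:(lra)).
  move: (10 * K / s) (_ / s) => A B; lra.
have k_sqr s : 2 * (s0 + 1) <= s -> 0 < k s -> p / 8 * k s ^+ 2 <= K1 / s.
  move=> ss ks; rewrite leNgt; apply/negP => ksK.
  have s_gt0 : 0 < s by move: s0_gt0; lra.
  pose c := p / 8 * k s ^+ 2 - K1 / s.
  have c0 : 0 < c by rewrite subr_gt0.
  (* Growth is shown down to half the value [k s], whence p / 8 = (p / 2) / 4; this slack is the
     margin for the barrier argument. *)
  have k1_gt t : s <= t -> k s / 2 <= k t -> c / t <= k1 t.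
    move=> st kt; have t0 := lt_le_trans s_gt0 st.
    have kt0 : 0 <= k t by apply: le_trans kt; lra.
    rewrite ler_pdivrMr// mulrC; apply: le_trans (k1_ge _ (le_trans ss st) kt0).
    have : (k s / 2) ^+ 2 <= k t ^+ 2 by rewrite ler_sqr ?nnegrE//; lra.
    move=> /(ler_wpM2l (_ : 0 <= p / 2)) => /(_ ltac:(lra)).
    have : 10 * K / t <= K1 / s.
      apply: (@le_trans _ _ (K1 / t)).
        by rewrite ler_pM2r ?invr_gt0// /K1; lra.
      by rewrite ler_pM2l// lef_pV2.
    by rewrite /c exprMn exprVn; lra.
  have k_ge t : s <= t -> k s <= k t.
    move=> st; rewrite -subr_ge0.
    apply: (@derive_barrier _ (fun u => k u - k s) k1 s t (k s / 2)) => //.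
    - by rewrite divr_gt0.
    - move=> u /andP[su _].
      have us : s0 < u by move: s0_gt0; lra.
      by have := is_deriveB (dk u us) (is_derive_cst (k s) u 1); rewrite subr0.
    - move=> u /andP[su _] ku; apply: lt_le_trans (k1_gt u su _).
        by rewrite divr_gt0// (lt_le_trans s_gt0).
      by lra.
    - by rewrite subrr.
  (* With this [t] the logarithmic growth c ln (t / s) equals [beta], the upper bound for [k]. *)
  pose t := s * expR (beta / c).
  have e1 : 1 <= expR (beta / c) by rewrite -expR0 ler_expR divr_ge0 ?ltW.
  have st : s <= t by rewrite /t ler_pMr.
  have : k s - c * ln s <= k t - c * ln t.
    apply: (@derive_ge0_le _ (fun u => k u - c * ln u) (fun u => k1 u - c / u)) => //.
      move=> u /andP[su _].
      have us : s0 < u by move: s0_gt0; lra.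
      exact: is_deriveB (dk u us) (is_derive_Ml c (is_derive1_ln (lt_trans s0_gt0 us))).
    move=> u /andP[su _]; rewrite subr_ge0 k1_gt//.
    by apply: le_trans (k_ge u su); lra.
  have t0 := lt_le_trans s_gt0 st.
  rewrite /t lnM ?posrE ?expR_gt0// expRK mulrDr [c * (_ / c)]mulrC divfK ?gt_eqF// -/t.
  have : k t < beta by apply: k_lt; move: s0_gt0; lra.
  lra.
exists (Num.sqrt (8 * K1 / p)); first exact: sqrtr_ge0.
move=> s ss; set C := Num.sqrt _.
have s_gt0 : 0 < s by move: s0_gt0; lra.
have sC0 : 0 <= C * s `^ (- 2^-1) by rewrite mulr_ge0 ?sqrtr_ge0 ?powR_ge0.
suff : k s <= C * s `^ (- 2^-1).
  rewrite powRB ?(gt_eqF s_gt0) ?implybT// powRr1 ?(ltW s_gt0)// /k => h.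
  rewrite -subr_ge0 -(pmulr_rge0 _ s_gt0).
  have -> : s * (y s - (kappa + beta / s - C * (s `^ (- 2^-1) / s))) =
    C * s `^ (- 2^-1) - (beta - s * (y s - kappa)) by field; rewrite gt_eqF.
  by rewrite subr_ge0.
have [ks|ks] := leP (k s) 0; first exact: le_trans sC0.
rewrite -ler_sqr ?nnegrE ?(ltW ks)// exprMn sqr_sqrtr; last by rewrite divr_ge0 ?mulr_ge0 ?ltW.
rewrite -(powR_mulrn 2 (powR_ge0 _ _)) -powRrM mulNr mulVf// powR_inv1 ?(ltW s_gt0)//.
have := k_sqr s ss ks; rewrite mulrC [p / 8]mulrC => /(ler_wpM2l (_ : 0 <= 8 / p)).
rewrite divr_ge0 ?(ltW p0)// => /(_ isT).
have -> : 8 / p * (k s ^+ 2 * (8^-1 * p)) = k s ^+ 2 by field; rewrite gt_eqF.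
by have -> : 8 / p * (K1 / s) = 8 * K1 / p / s by field; rewrite !gt_eqF.
Qed.

(** The error s^(-3/2) in the bound for [y] is integrable, so integration costs only a constant; its
    primitive is the last term of [f]. *)
Lemma supersolution_growth : exists S c, s0 < S /\
  forall s, S <= s -> kappa * s + beta * ln s - c <= l s.
Proof.
have [C C0 CP] := riccati_excess_ge.
pose S := 2 * (s0 + 1); pose f s := l s - (kappa * s + beta * ln s + 2 * C * s `^ (- 2^-1)).
have S0 : s0 < S by rewrite /S; move: s0_gt0; lra.
exists S, (- f S); split=> // s Ss.
have : f S <= f s.
  apply: (@derive_ge0_le _ f (fun s => y s - (kappa + beta / s - C * s `^ (- 2^-1 - 1)))) => //.
    move=> t /andP[St _]; have t_gt := lt_le_trans S0 St.
    have t0 := lt_trans s0_gt0 t_gt.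
    have h := is_deriveB (dl t_gt) (is_deriveD (is_deriveD (is_derive_Ml kappa (is_derive_id t 1))
       (is_derive_Ml beta (is_derive1_ln t0))) (is_derive_Ml (2 * C) (is_derive1_powR (- 2^-1) t0))).
    apply: is_derive_eq h _; rewrite mulr1; congr (_ - _).
    move: (_ `^ _) => A; field; exact: lt0r_neq0.
  by move=> t /andP[St _]; rewrite subr_ge0; apply: CP.
have : 0 <= 2 * C * s `^ (- 2^-1) by rewrite !mulr_ge0 ?powR_ge0.
rewrite [f s]/f; lra.
Qed.

End SupersolutionGrowth.

(** * Slowly growing strict subsolutions *)

Section Subsolution.
Context {R : realType}.
Variables (p kappa eps beta betabar : R).
Hypotheses (p2 : 2 <= p) (kappa0 : 0 < kappa) (eps0 : 0 < eps).
Hypotheses (beta0 : 0 < beta) (beta_le : beta <= betabar).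
Hypothesis sumb : beta + betabar = 2 / p.
Hypothesis prodb : beta * betabar = 2 / p * (eps / ((p - 1) * kappa `^ (p - 2))).

(** The curve h = H (ln s - t1) for large t1: the margin m / T^2, T = ln s - t1, absorbs the
    O(1/s) error of the rescaled Riccati inequality because 1/s = exp (- t1 - T).  The last
    conclusion lets the resulting function outgrow exp (kappa s) (s - s1) at S0. *)
Lemma subsolution_of_exponent (L H H1 : R -> R) (T0 m M s1 : R) :
  0 < T0 -> 0 < m -> 0 < s1 ->
  (forall T : R, 0 < T -> is_derive T 1 L (H T - betabar)) ->
  (forall T : R, 0 < T -> is_derive T 1 H (H1 T)) ->
  (forall T : R, T0 <= T -> betabar <= H T <= M) ->
  (forall T : R, T0 <= T -> m / T ^+ 2 <= H1 T + p / 2 * (H T - beta) * (H T - betabar)) ->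
  H T0 = betabar + 1 ->
  exists t1, let S0 := expR (t1 + T0) in
    let y s := kappa + H (ln s - t1) / s in
    let y1 s := (H1 (ln s - t1) - H (ln s - t1)) / s ^+ 2 in
    [/\ 1 <= t1 /\ s1 < S0,
     forall s, expR t1 < s ->
       is_derive s 1 (fun s => kappa * s + betabar * ln s + L (ln s - t1)) (y s) /\
       is_derive s 1 y (y1 s),
     forall s, S0 <= s -> 0 < y s /\ 0 < riccati p kappa eps s (y s) (y1 s) &
     kappa + (S0 - s1)^-1 < y S0].
Proof.
move=> T00 m0 s10 dL dH HM Hm HT0.
have [K K0 KP] := riccati_le0_rescaled p2 kappa0 eps0 sumb prodb.
have betabar0 : 0 < betabar by exact: lt_le_trans beta_le.
have M0 : 0 <= M.
  by have /andP[h1 h2] := HM _ (lexx T0); rewrite (le_trans (ltW betabar0))// (le_trans h1).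
(* The summands ensure in turn t1 >= 1, 1 / (S0 - s1) < (betabar + 1) / S0, and m X >= 2 K (M^3 +
   M). *)
pose X := expR 1 + (betabar + 1) * s1 / betabar + 2 * K * (M ^+ 3 + M) / m.
have A1 : 0 < (betabar + 1) * s1 / betabar by rewrite divr_gt0// mulr_gt0// addr_gt0.
have A2 : 0 <= 2 * K * (M ^+ 3 + M) / m.
  apply: divr_ge0; last exact: ltW.
  by apply: mulr_ge0; [exact: mulr_ge0 | apply: addr_ge0 => //; exact: exprn_ge0].
have X0 : 0 < X by rewrite /X; have := expR_gt0 (1 : R); lra.
exists (ln X) => S0 y y1.
have XE : expR (ln X) = X by rewrite lnK// posrE.
have S0E : S0 = X * expR T0 by rewrite /S0 expRD XE.
have e1 : 1 < expR T0 by rewrite expR_gt1.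
have XS0 : X < S0 by rewrite S0E ltr_pMr.
have S00 := lt_trans X0 XS0.
have s1S : (betabar + 1) * s1 < betabar * S0.
  rewrite [betabar * S0]mulrC -ltr_pdivrMr//; apply: le_lt_trans XS0; rewrite /X.
  have := expR_gt0 (1 : R); lra.
have s1S0 : s1 < S0 by rewrite -(ltr_pM2l betabar0); lra.
have dT (s : R) : 0 < s -> is_derive s 1 (fun s => ln s - ln X) s^-1.
  by move=> s0; have := is_deriveB (is_derive1_ln s0) (is_derive_cst (ln X) s 1); rewrite subr0.
have T_gt0 s : X < s -> 0 < ln s - ln X.
  by move=> Xs; rewrite subr_gt0 ltr_ln ?posrE// (lt_trans X0).
split.
- split=> //; rewrite -ler_expR XE /X; lra.
- rewrite XE => s Xs; have s0 := lt_trans X0 Xs; have T0s := T_gt0 _ Xs.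
  split.
  + have h := @is_derive1_comp _ L (fun s => ln s - ln X) s _ _ (dL _ T0s) (dT _ s0).
    have := is_deriveD (is_deriveD (is_derive_Ml kappa (is_derive_id s 1))
      (is_derive_Ml betabar (is_derive1_ln s0))) h.
    by move=> h2; apply: is_derive_eq h2 _; rewrite /y; ring.
  + have h := @is_derive1_comp _ H (fun s => ln s - ln X) s _ _ (dH _ T0s) (dT _ s0).
    have sn : s != 0 by rewrite gt_eqF.
    have := is_deriveD (is_derive_cst kappa s 1) (is_deriveM h (@is_deriveV _ id s _ _ sn (is_derive_id s 1))).
    move=> h2; apply: is_derive_eq h2 _; rewrite /y1 /GRing.scale /=.
    by field.
- move=> s S0s; have Xs := lt_le_trans XS0 S0s; have s0 := lt_trans X0 Xs.
  set T := ln s - ln X.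
  have T0T : T0 <= T.
    rewrite /T lerBrDl -(expRK (ln X + T0)) -/S0 ler_ln ?posrE//.
  have /andP[bH HM'] := HM _ T0T.
  have H0 : 0 <= H T by apply: le_trans bH; exact: ltW.
  split; first by rewrite /y ltr_pwDl// divr_ge0// ltW.
  rewrite ltNge; apply/negP => /(KP _ _ _ s0 H0).
  apply/negP; rewrite -ltNge; apply: lt_le_trans (Hm _ T0T).
  have TT : 0 < T by exact: lt_le_trans T0T.
  have sE : s = X * expR T by rewrite /T expRD expRN XE lnK ?posrE//; field; rewrite gt_eqF.
  (* Exponential growth of s = X exp T against T^2 / 2 makes the error K (h^3 + h) / s smaller than
     m / T^2. *)
  have hs : X * (T ^+ 2 / 2) < s.
    rewrite sE ltr_pM2l//; have := expR_ge1Dxn 1 (ltW TT); rewrite !factS fact0; lra.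
  have T2 : 0 < T ^+ 2 by rewrite exprn_gt0.
  rewrite ltr_pdivrMr// mulrAC ltr_pdivlMr//.
  have : m * (X * (T ^+ 2 / 2)) < m * s by rewrite ltr_pM2l.
  apply: le_lt_trans.
  have : 2 * K * (M ^+ 3 + M) <= m * X.
    rewrite [m * X]mulrC -ler_pdivrMr// /X; have := expR_gt0 (1 : R); lra.
  have hM : K * (H T ^+ 3 + H T) <= K * (M ^+ 3 + M).
    by rewrite ler_wpM2l// lerD// lerXn2r ?nnegrE.
  move=> hX; have : 2 * (K * (H T ^+ 3 + H T)) <= m * X by lra.
  by move=> /(ler_wpM2r (ltW T2)); lra.
rewrite /y expRK addrAC subrr add0r HT0 ltrD2l ltr_pdivlMr// mulrC ltr_pdivrMr ?subr_gt0//.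
by lra.
Qed.

(** For distinct roots h = betabar + D / T^2 suffices and [L] stays negative; for a double root h =
    betabar + tau / T is used, whose primitive costs exactly a factor T^tau. *)
Lemma subsolution_exists (tau s1 : R) : 0 < s1 ->
  (beta < betabar /\ 0 < tau) \/ (beta = betabar /\ 2 / p < tau) ->
  exists Sa S0 (l y y1 : R -> R),
    [/\ expR 1 <= Sa, Sa < S0 & s1 < S0] /\
    [/\ forall s, Sa < s -> is_derive s 1 l (y s) /\ is_derive s 1 y (y1 s),
     forall s, S0 <= s -> 0 < y s /\ 0 < riccati p kappa eps s (y s) (y1 s),
     kappa + (S0 - s1)^-1 < y S0 &
     forall s, S0 <= s -> l s <= kappa * s + betabar * ln s + tau * ln (ln s)].
Proof.
move=> s10 cases; have p0 : 0 < p by exact: lt_le_trans p2.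
(* Here [z] stands for ln s = t1 + T, and z >= T + 1 because t1 >= 1. *)
suff [L [H [H1 [T0 [m [M [T00 m0 [dL dH HM Hm] HT0 Lle]]]]]]] :
    exists (L H H1 : R -> R) (T0 m M : R), [/\ 0 < T0, 0 < m, 
     [/\ forall T : R, 0 < T -> is_derive T 1 L (H T - betabar),
      forall T : R, 0 < T -> is_derive T 1 H (H1 T),
      forall T : R, T0 <= T -> betabar <= H T <= M &
      forall T : R, T0 <= T -> m / T ^+ 2 <= H1 T + p / 2 * (H T - beta) * (H T - betabar)],
      H T0 = betabar + 1 &
      forall T z, T0 <= T -> T + 1 <= z -> L T <= tau * ln z].
  have [t1 [[t11 sS0] dly ric yS0]] := subsolution_of_exponent T00 m0 s10 dL dH HM Hm HT0.
  exists (expR t1), (expR (t1 + T0)), (fun s => kappa * s + betabar * ln s + L (ln s - t1)),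
    (fun s => kappa + H (ln s - t1) / s), (fun s => (H1 (ln s - t1) - H (ln s - t1)) / s ^+ 2).
  split; first by split; rewrite ?ler_expR ?ltr_expR ?ltrDl.
  split; [exact: dly | exact: ric | exact: yS0 |].
  move=> s S0s; rewrite lerD2l; have s0 : 0 < s by apply: lt_le_trans S0s; exact: expR_gt0.
  have : t1 + T0 <= ln s by rewrite -ler_expR lnK ?posrE.
  move=> h; apply: Lle; lra.
have dT2 (T : R) : 0 < T -> is_derive T 1 (fun T => T^-1) (- T ^- 2).
  move=> T00; have Tn : T != 0 by rewrite gt_eqF.
  by have := @is_deriveV _ id T 1 1 Tn (is_derive_id T 1); rewrite [_%:A]mulr1.
case: cases => [[bb tau0]|[bb tau0]].
- pose de := betabar - beta; have de0 : 0 < de by rewrite subr_gt0.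
  (* The bound D > 8 / (p^2 de) makes (p / 2) D x^2 - 2 x + (p / 4) de nonnegative for every x = 1 /
     T, by completing the square. *)
  pose D := 1 + 8 / (p ^+ 2 * de).
  have D8 : 8 / (p ^+ 2 * de) < D by rewrite /D ltrDr.
  have D1 : 1 <= D by rewrite /D lerDl divr_ge0// mulr_ge0 ?exprn_ge0 ?ltW.
  have D0 : 0 < D by exact: lt_le_trans D1.
  (* Chosen so that D / T0^2 = 1, that is, [h] starts at betabar + 1. *)
  pose T0 := Num.sqrt D.
  have T00 : 0 < T0 by rewrite sqrtr_gt0.
  have T0sq : T0 ^+ 2 = D by rewrite sqr_sqrtr// ltW.
  have dn (T : R) : 0 < T -> is_derive T 1 (fun T => T ^- 2) (- (2 / T ^+ 3)).
    move=> TT; have T2 : T ^+ 2 != 0 by rewrite expf_neq0// gt_eqF.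
    have dsq : is_derive T 1 (fun T : R => T ^+ 2) (2 * T).
      by apply: is_derive_eq; rewrite /GRing.scale /=; ring.
    have h := @is_deriveV _ (fun T => T ^+ 2) T _ 1 T2 dsq.
    by apply: is_derive_eq h _; rewrite /GRing.scale /=; field; rewrite gt_eqF.
  exists (fun T => - D * T^-1), (fun T => betabar + D * T ^- 2), (fun T => D * - (2 / T ^+ 3)),
    T0, (D * (p / 4 * de)), (betabar + 1).
  split; first exact: T00.
  + by rewrite !mulr_gt0 ?invr_gt0.
  + split.
    * move=> T TT; apply: is_derive_eq (is_derive_Ml (- D) (dT2 _ TT)) _; ring.
    * move=> T TT; have := is_deriveD (is_derive_cst betabar T 1) (is_derive_Ml D (dn _ TT)).
      by rewrite add0r.
    * move=> T T0T; have TT := lt_le_trans T00 T0T.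
      rewrite lerDl lerD2l divr_ge0 ?exprn_ge0 ?(ltW D0) ?(ltW TT)//=.
      by rewrite ler_pdivrMr ?exprn_gt0// mul1r -T0sq ler_sqr ?nnegrE ?(ltW T00) ?(ltW TT).
    * move=> T T0T; have TT := lt_le_trans T00 T0T.
      have -> : D * - (2 / T ^+ 3) + p / 2 * (betabar + D * T ^- 2 - beta) * (betabar + D * T ^- 2 - betabar)
        = D * (p / 2 * de + p / 2 * D * T^-1 ^+ 2 - 2 * T^-1) / T ^+ 2.
        by rewrite /de; field; rewrite gt_eqF.
      rewrite ler_pM2r ?invr_gt0 ?exprn_gt0// ler_pM2l//.
      move: T^-1 => x; have pD : 0 < p * D by rewrite mulr_gt0.
      have : 0 <= (p * D * x - 2) ^+ 2 by exact: sqr_ge0.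
      have : 8 < p ^+ 2 * de * D.
        by move: D8; rewrite ltr_pdivrMr ?mulr_gt0 ?exprn_gt0// mulrC.
      rewrite -subr_ge0 -(pmulr_rge0 _ (_ : 0 < 2 * (p * D))) ?mulr_gt0//.
      move=> h1 h2.
      have -> : 2 * (p * D) * (p / 2 * de + p / 2 * D * x ^+ 2 - 2 * x - p / 4 * de) =
        (p * D * x - 2) ^+ 2 + (p ^+ 2 * de * D / 2 - 4) by field.
      lra.
  + by rewrite T0sq mulfV ?gt_eqF.
  + move=> T z T0T Tz; have TT := lt_le_trans T00 T0T.
    apply: (@le_trans _ _ 0); first by rewrite mulNr oppr_le0 divr_ge0 ?ltW.
    rewrite mulr_ge0 ?(ltW tau0) ?ln_ge0//; lra.
(* For the double root, H' + (p / 2) (H - betabar)^2 equals tau (p tau / 2 - 1) / T^2, positive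
   exactly because tau > 2 / p. *)
- have tau00 : 0 < tau by apply: lt_trans tau0; rewrite divr_gt0.
  have ptau : 1 < p / 2 * tau by move: tau0; rewrite ltr_pdivrMr// => h; lra.
  exists (fun T => tau * ln T), (fun T => betabar + tau * T^-1), (fun T => tau * - T ^- 2),
    tau, (tau * (p / 2 * tau - 1)), (betabar + 1).
  split; first exact: tau00.
  + by rewrite mulr_gt0// subr_gt0.
  + split.
    * move=> T TT; rewrite addrAC subrr add0r; exact: is_derive_Ml (is_derive1_ln TT).
    * move=> T TT; have := is_deriveD (is_derive_cst betabar T 1) (is_derive_Ml tau (dT2 _ TT)).
      by rewrite add0r.
    * move=> T T0T; have TT := lt_le_trans tau00 T0T.
      by rewrite lerDl lerD2l divr_ge0 ?(ltW tau00) ?(ltW TT)//= ler_pdivrMr// mul1r.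
    * move=> T T0T; have TT := lt_le_trans tau00 T0T.
      rewrite bb le_eqVlt; apply/orP; left; apply/eqP; field; rewrite gt_eqF//.
  + by rewrite mulfV ?gt_eqF.
  + move=> T z T0T Tz; have TT := lt_le_trans tau00 T0T.
    rewrite ler_wpM2l ?(ltW tau00)// ler_ln ?posrE//; lra.
Qed.

End Subsolution.

(** * Comparison on annuli *)

Section Annulus.
Context {R : realType} {N : nat}.
Implicit Types x : 'rV[R]_N.

Lemma enormZ (a : R) x : 0 <= a -> enorm (a *: x) = a * enorm x.
Proof.
move=> a0; rewrite /enorm (eq_bigr (fun i => a ^+ 2 * x 0 i ^+ 2)).
  by rewrite -mulr_sumr sqrtrM ?sqr_ge0// sqrtr_sqr ger0_norm.
by move=> i _; rewrite mxE exprMn.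
Qed.

Lemma enorm_scale_evec (a : R) (i : 'I_N) : 0 <= a -> enorm (a *: evec R i) = a.
Proof. by move=> a0; rewrite enormZ// enorm_evec mulr1. Qed.

Lemma near_gt_enorm r x : enorm x < r -> \forall y \near x, enorm y < r.
Proof. by move=> rx; exact: (cvgr_lt _ (@continuous_enorm R N x) _ rx). Qed.

Lemma compact_annulus (a b : R) : compact [set x : 'rV[R]_N | a <= enorm x <= b].
Proof.
apply: bounded_closed_compact.
  exists b; split; first exact: num_real.
  move=> M bM x /= /andP[_ xb].
  rewrite [leLHS]/Num.Def.normr /= mx_normrE; apply: bigmax_le => [|[i j] _].
    by rewrite (le_trans (enorm_ge0 x))// (le_trans xb)// ltW.
  rewrite ord1 (le_trans (abs_coord_le_enorm x j))// (le_trans xb)// ltW //.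
have -> : [set x | a <= enorm x <= b] = @enorm R N @^-1` `[a, b].
  by apply/seteqP; split=> x /=; rewrite in_itv.
apply: closed_comp => [x _|]; first exact: continuous_enorm.
exact: interval_closed.
Qed.

Lemma annulus_max (f : 'rV[R]_N -> R) (a b : R) : (0 < N)%N -> 0 <= a <= b ->
  (forall x, a <= enorm x <= b -> {for x, continuous f}) ->
  exists2 c, a <= enorm c <= b & forall x, a <= enorm x <= b -> f x <= f c.
Proof.
move=> N0 /andP[a0 ab] cf.
have [||c] := @compact_EVT_max _ R f _ _ (@compact_annulus a b).
- by exists (a *: evec R (Ordinal N0)); rewrite /= enorm_scale_evec// lexx.
- by apply: continuous_in_subspaceT => x; rewrite inE /=; exact: cf.
- by rewrite inE /= => cab cmax; exists c => // x xab; apply: cmax; rewrite inE.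
Qed.

End Annulus.

(** Scaling the comparison function until the maximal quotient is 1 makes it touch [w] from below.
    This adds a constant to [l] and leaves its derivatives unchanged. *)
Lemma interior_max_riccati (R : realType) (N : nat) (p kappa eps r1 : R) (w : 'rV[R]_N -> R)
    (x : 'rV[R]_N) (l y : R -> R) (y1 : R) :
  2 <= p -> p * kappa = p - N%:R -> C2_on_ext r1 w -> r1 < enorm x -> 0 < enorm x ->
  (\forall s \near ln (enorm x), is_derive (s : R) 1 l (y s)) ->
  is_derive (ln (enorm x)) 1 y y1 -> 0 < y (ln (enorm x)) ->
  (\forall z \near x, 0 < w z) ->
  (\forall z \near x, expR (l (ln (enorm z))) / w z <= expR (l (ln (enorm x))) / w x) ->
  0 <= eqLHS p (kappa `^ p) eps w x ->
  riccati p kappa eps (ln (enorm x)) (y (ln (enorm x))) y1 <= 0.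
Proof.
move=> p2 pk wC2 rx x0 dl dy y0 w0 max super.
have wx0 := nbhs_singleton w0.
pose c := ln (w x) - l (ln (enorm x)).
have touch : expR (l (ln (enorm x)) + c) = w x by rewrite /c subrKC lnK.
have below : \forall z \near x, expR (l (ln (enorm z)) + c) <= w z.
  near=> z; have wz0 : 0 < w z by near: z.
  have : expR (l (ln (enorm z))) / w z <= expR (l (ln (enorm x))) / w x by near: z.
  rewrite ler_pdivrMr// expRD -touch expRD => /(ler_wpM2r (expR_ge0 c)) /le_trans; apply.
  have e0 := expR_gt0 (l (ln (enorm x))); have c0 := expR_gt0 c.
  rewrite le_eqVlt; apply/orP; left; apply/eqP.
  by field; rewrite !gt_eqF.
have dlc : \forall s \near ln (enorm x), is_derive (s : R) 1 (fun s => l s + c) (y s).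
  near=> s; have ds : is_derive s 1 l (y s) by near: s.
  by have := is_deriveD ds (is_derive_cst c s 1); rewrite addr0.
have := touching_riccati wC2 rx x0 dlc dy below touch p2 y0 wx0 super.
by rewrite /riccati pk.
Unshelve. all: by end_near. Qed.

(** Beyond radius e the bases |x|, ln |x| and ln ln |x| are all positive, so the convention for
    powers of 0 does not intervene. *)
Lemma profileE (R : realType) (N : nat) (p beta tau : R) (x : 'rV[R]_N) : 1 < ln (enorm x) ->
  profile p beta tau x = expR ((p - N%:R) / p * ln (enorm x) + beta * ln (ln (enorm x))
    + tau * ln (ln (ln (enorm x)))).
Proof.
move=> x1; have lnx0 : 0 < ln (enorm x) by exact: lt_trans x1.
have x0 : 0 < enorm x by rewrite ltNge; apply/negP => /ln0 e; rewrite e ltxx in lnx0.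
by rewrite /profile /powR (gt_eqF x0) (gt_eqF lnx0) (gt_eqF (ln_gt0 x1)) !expRD.
Qed.

(** * Growth of supersolutions in the exterior domain *)

Section Main.
Context {R : realType} {N : nat}.
Variables (p kappa eps beta betabar r0 : R).
Hypotheses (N0 : (0 < N)%N) (p2 : 2 <= p) (kappa0 : 0 < kappa) (eps0 : 0 < eps).
Hypotheses (pk : p * kappa = p - N%:R) (r0e : expR 1 < r0).
Hypotheses (beta0 : 0 < beta) (beta_le : beta <= betabar).
Hypothesis sumb : beta + betabar = 2 / p.
Hypothesis prodb : beta * betabar = 2 / p * (eps / ((p - 1) * kappa `^ (p - 2))).

Let r0_gt0 : 0 < r0. Proof. exact: lt_trans (expR_gt0 _) r0e. Qed.

Let ln_r0 : 1 < ln r0. Proof. by rewrite -ltr_expR lnK. Qed.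

Let ln_gt1 (r : R) : r0 <= r -> 1 < ln r.
Proof.
move=> rr; apply: lt_le_trans ln_r0 _; rewrite ler_ln// posrE.
exact: lt_le_trans rr.
Qed.

Let profileE' (b tau : R) (x : 'rV[R]_N) : r0 <= enorm x ->
  profile p b tau x = expR (kappa * ln (enorm x) + b * ln (ln (enorm x))
    + tau * ln (ln (ln (enorm x)))).
Proof.
move=> /ln_gt1 /profileE ->; rewrite -pk mulrC [p * kappa]mulrC mulfK 1?mulrC//.
by rewrite gt_eqF// (lt_le_trans _ p2).
Qed.

(** The Riccati growth bound settles large |x|; on the remaining bounded annulus monotonicity keeps
    [v] above its value on the inner sphere. *)
Lemma radial_supersolution_growth (v : 'rV[R]_N -> R) (tau : R) :
  (forall x, r0 <= enorm x -> 0 < v x) -> radial_strictly_increasing r0 v ->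
  C2_supersolution p (kappa `^ p) eps r0 v -> tau < 0 ->
  exists C : R, 0 < C /\ forall x, r0 <= enorm x -> profile p beta tau x <= C * v x.
Proof.
move=> v_gt0 [phi [vphi dphi]] [[r1 [r1r0 vC2]] super] tau0.
(* [phi] is only known to be differentiable once; the restriction of [v] to an axis supplies two
   derivatives. *)
pose i0 := Ordinal N0; pose psi (r : R) := v (r *: evec R i0).
have phiE r : r0 <= r -> phi r = psi r.
  move=> rr; have r_ge0 := le_trans (ltW r0_gt0) rr.
  by rewrite /psi vphi enorm_scale_evec.
have psiE x : r0 <= enorm x -> v x = psi (enorm x) by move=> xr; rewrite -phiE// vphi.
have enormr r : r0 < r -> r1 < enorm (r *: evec R i0).
  by move=> rr; rewrite enorm_scale_evec ?(lt_trans r1r0)// ltW// (lt_trans r0_gt0).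
pose psi1 (r : R) := partial i0 v (r *: evec R i0).
pose psi2 (r : R) := partial i0 (partial i0 v) (r *: evec R i0).
have line (f : 'rV[R]_N -> R) (r d : R) : is_derive (r *: evec R i0) (evec R i0) f d ->
    is_derive r 1 (fun r => f (r *: evec R i0)) d.
  have := @is_derive_line R N f 0 (evec R i0) r d; rewrite add0r => -[h _] /h.
  by under eq_fun do rewrite add0r.
have dpsi r : r0 < r -> is_derive r 1 psi (psi1 r).
  move=> /enormr rr; apply: line.
  by have := C2_is_derive vC2 (evec R i0) rr; rewrite sum_evec.
have dpsi1 r : r0 < r -> is_derive r 1 psi1 (psi2 r).
  move=> /enormr rr; apply: line.
  by have := C2_is_derive_partial vC2 (evec R i0) i0 rr; rewrite sum_evec.
have psi_gt0 r : r0 <= r -> 0 < psi r.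
  by move=> rr; apply: v_gt0; rewrite enorm_scale_evec// (le_trans (ltW r0_gt0)).
have psi1_gt0 r : r0 < r -> 0 < psi1 r.
  move=> rr; have [dr] := dphi r (ltW rr).
  have : is_derive r 1 phi (psi1 r).
    apply: near_eq_is_derive (dpsi r rr).
    near=> t; rewrite phiE//; apply: ltW; near: t; exact: lt_nbhsr.
  by rewrite derive1E => -[_ ->].
have psi_incr r : r0 <= r -> psi r0 <= psi r.
  move=> rr; rewrite -!phiE//.
  apply: (@derive_ge0_le _ phi (fun t => phi^`() t)) => // t /andP[t0 _].
    by have [dt _] := dphi t t0; rewrite derive1E; exact: derivableP.
  by have [_ /ltW] := dphi t t0.
pose s0 := ln r0; have s00 : 0 < s0 by exact: lt_trans ln_r0.
have expr s : s0 < s -> r0 < expR s by rewrite -ltr_expR lnK.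
pose l (s : R) := ln (psi (expR s)).
pose y (s : R) := expR s * psi1 (expR s) / psi (expR s).
pose y1 (s : R) := (expR s * psi1 (expR s) + expR s ^+ 2 * psi2 (expR s)) / psi (expR s)
   - y s ^+ 2.
have dcomp (f f1 : R -> R) s : is_derive (expR s) 1 f (f1 (expR s)) ->
    is_derive s 1 (fun s => f (expR s)) (f1 (expR s) * expR s).
  by move=> h; exact: is_derive1_comp h (is_derive_expR s).
have dl s : s0 < s -> is_derive s 1 l (y s).
  move=> /expr rs; have p0 := psi_gt0 _ (ltW rs).
  have h := @is_derive1_comp _ (@ln R) (fun s => psi (expR s)) s _ _ (is_derive1_ln p0)
    (dcomp _ _ _ (dpsi _ rs)).
  by apply: is_derive_eq h _; rewrite /y mulrC [psi1 _ * _]mulrC.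
have dy s : s0 < s -> is_derive s 1 y (y1 s).
  move=> /expr rs; have p0 := psi_gt0 _ (ltW rs); have pn : psi (expR s) != 0 by rewrite gt_eqF.
  have h1 := is_deriveM (is_derive_expR s) (dcomp _ _ _ (dpsi1 _ rs)).
  have h2 := @is_deriveV _ (fun s => psi (expR s)) s _ 1 pn (dcomp _ _ _ (dpsi _ rs)).
  apply: is_derive_eq (is_deriveM h1 h2) _.
  rewrite -[((expR : R -> R) * _) s]/(expR s * psi1 (expR s)) /y1 /y /GRing.scale /=.
  by field.
have y_gt0 s : s0 < s -> 0 < y s.
  by move=> /expr rs; rewrite divr_gt0 ?mulr_gt0 ?expR_gt0 ?psi1_gt0 ?psi_gt0 ?ltW.
have ric s : s0 < s -> riccati p kappa eps s (y s) (y1 s) <= 0.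
  move=> s0s; have rs := expr _ s0s.
  pose x := expR s *: evec R i0 : 'rV[R]_N.
  have xE : enorm x = expR s by rewrite enorm_scale_evec// expR_ge0.
  have lnx : ln (enorm x) = s by rewrite xE expRK.
  (* The quotient is constantly 1, so every point is a maximum and the touching argument applies
     everywhere. *)
  have ratio z : r0 < enorm z -> expR (l (ln (enorm z))) / v z = 1.
    move=> rz; have z0 := lt_trans r0_gt0 rz.
    rewrite /l [expR (ln (enorm z))]lnK ?posrE// lnK ?posrE ?psi_gt0 ?ltW//.
    by rewrite psiE ?divff ?gt_eqF ?psi_gt0// ltW.
  have rx : r0 < enorm x by rewrite xE.
  have := @interior_max_riccati R N p kappa eps r1 v x l y (y1 s) p2 pk vC2.
  rewrite lnx; apply.
  - exact: lt_trans rx.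
  - exact: lt_trans rx.
  - by near=> t; apply: dl; near: t; exact: lt_nbhsr.
  - exact: dy.
  - exact: y_gt0.
  - by near=> z; apply: v_gt0; apply: ltW; near: z; exact: near_lt_enorm.
  - near=> z; rewrite ratio; last by near: z; exact: near_lt_enorm.
    by rewrite -[in leRHS]lnx ratio.
  - exact: super.
have [S [c [S0 lS]]] :=
  supersolution_growth p2 kappa0 eps0 s00 beta0 beta_le sumb prodb dl dy y_gt0 ric.
(* As tau < 0, [b] bounds the log-log exponent from above for s >= s0; [D] handles s < S. *)
pose b := tau * ln (ln s0); pose D := expR (kappa * S + beta * ln S + b) / psi r0.
exists (expR (c + b) + D).
have D0 : 0 < D by rewrite divr_gt0 ?expR_gt0 ?psi_gt0.
split; first by rewrite addr_gt0 ?expR_gt0.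
move=> x rx; rewrite profileE'// psiE//; set s := ln (enorm x).
have x0 := lt_le_trans r0_gt0 rx.
have s0s : s0 <= s by rewrite ler_ln// posrE.
have sp : 0 < s := lt_le_trans s00 s0s.
have tb : tau * ln (ln s) <= b.
  rewrite ler_nM2l// ler_ln ?posrE ?ln_gt0// ?ler_ln ?posrE//.
  exact: lt_le_trans s0s.
have pe : psi (enorm x) = expR (l s) by rewrite /l [expR s]lnK ?posrE// lnK ?posrE ?psi_gt0.
have psix0 := ltW (psi_gt0 _ rx).
have [Ss|sS] := leP S s.
  rewrite mulrDl -[leLHS]addr0; apply: lerD; last by apply: mulr_ge0 => //; exact: ltW.
  by rewrite pe -expRD ler_expR; have := lS s Ss; lra.
rewrite mulrDl -[leLHS]add0r; apply: lerD; first by apply: mulr_ge0 => //; exact: expR_ge0.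
rewrite /D mulrAC ler_pdivlMr ?psi_gt0//.
apply: ler_pM; rewrite ?expR_ge0 ?psi_incr// ?(ltW (psi_gt0 _ _))// ler_expR.
apply: lerD => //; apply: lerD; rewrite ler_wpM2l ?(ltW kappa0) ?(ltW beta0) ?(ltW sS)//.
by rewrite ler_ln ?posrE ?(ltW sS)// (lt_trans s00).
Unshelve. all: by end_near. Qed.

(** By contradiction: if the quotient tends to 0, two overlapping barriers divided by [w] have an
    interior maximum, where one of them would satisfy the Riccati inequality that it violates. *)
Lemma supersolution_growth_limsup (w : 'rV[R]_N -> R) (tau : R) :
  (forall x, r0 <= enorm x -> 0 < w x) -> C2_supersolution p (kappa `^ p) eps r0 w ->
  (beta < betabar /\ 0 < tau) \/ (beta = betabar /\ 2 / p < tau) ->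
  exists c : R, 0 < c /\
    forall M : R, exists x, M < enorm x /\ r0 <= enorm x /\ c <= profile p betabar tau x / w x.
Proof.
move=> w_gt0 [[r1 [r1r0 wC2]] super] cases.
pose s1 := ln r0; have s10 : 0 < s1 by exact: lt_trans ln_r0.
have [Sa [S0 [l [y [y1 [[Sa1 SaS s1S] [dly ric yS lle]]]]]]] :=
  subsolution_exists p2 kappa0 eps0 beta0 beta_le sumb prodb s10 cases.
apply: contrapT => noc.
have decay c : 0 < c -> exists M, forall x, M < enorm x -> r0 <= enorm x ->
    profile p betabar tau x / w x < c.
  move=> c0; apply: contrapT => noM; apply: noc; exists c; split=> // M.
  apply: contrapT => nox; apply: noM; exists M => x Mx rx.
  by rewrite ltNge; apply/negP => cx; apply: nox; exists x.
pose l1 a (s : R) := a + kappa * s + ln (s - s1).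
pose g s := l s - l1 0 s.
have dln s : s1 < s -> is_derive s 1 (fun s => ln (s - s1)) (s - s1)^-1.
  move=> ss; have ds := is_deriveB (is_derive_id s 1) (is_derive_cst s1 s 1).
  have h0 : 0 < s - s1 by rewrite subr_gt0.
  have := @is_derive1_comp _ (@ln R) (fun s => s - s1) s _ _ (is_derive1_ln h0) ds.
  by rewrite subr0 mulr1.
have dl1 a s : s1 < s -> is_derive s 1 (l1 a) (kappa + (s - s1)^-1).
  move=> ss; have := is_deriveD (is_deriveD (is_derive_cst a s 1)
    (is_derive_Ml kappa (is_derive_id s 1))) (dln s ss).
  by rewrite add0r mulr1.
(* At [S0] the slope of [l] exceeds that of [l1 0], so [g] takes a larger value slightly beyond; a
   shift strictly between the two values reverses the order of the barriers from [S0] to [S1]. *)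
have [S1 S01 gS] : exists2 S1, S0 < S1 & g S0 < g S1.
  have [dlS _] := dly S0 SaS.
  have [|e e0 eP] := is_derive_gt0_right (is_deriveB dlS (dl1 0 S0 s1S)); first by rewrite subr_gt0.
  exists (S0 + e / 2); first by rewrite ltrDl divr_gt0.
  by apply: eP; rewrite divr_gt0// ltr_pdivrMr// ltr_pMr// ltr1n.
pose a := (g S0 + g S1) / 2. (* so that f2 < f1 at s = S0 and f1 < f2 at s = S1 *)
(* Written as a product so that it vanishes continuously at |x| = r0, where ln (s - s1) would take
   the default value ln 0 = 0. *)
pose f1 x := expR (a + kappa * ln (enorm x)) * (ln (enorm x) - s1) / w x.
pose f2 x := expR (l (ln (enorm x))) / w x.
have f1E x : s1 < ln (enorm x) -> f1 x = expR (l1 a (ln (enorm x))) / w x.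
  by move=> sx; rewrite /f1 /l1 [in RHS]expRD lnK// posrE subr_gt0.
have expS s : s1 < s -> r0 < expR s by rewrite -ltr_expR lnK.
have rS0 := expS _ s1S; have rS1 := expS _ (lt_trans s1S S01).
have eS01 : expR S0 < expR S1 by rewrite ltr_expR.
have near_w x : r0 < enorm x -> \forall z \near x, 0 < w z.
  by move=> rx; near=> z; apply: w_gt0; apply: ltW; near: z; exact: near_lt_enorm.
pose x0 := expR S0 *: evec R (Ordinal N0) : 'rV[R]_N.
have x0E : enorm x0 = expR S0 by rewrite enorm_scale_evec// expR_ge0.
have f2x0 : 0 < f2 x0 by rewrite divr_gt0 ?expR_gt0// w_gt0// x0E ltW.
have [M MP] := decay _ f2x0.
(* Far enough out that the second quotient stays below [f2 x0] on the sphere of radius [Rm]. *)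
pose Rm := Num.max M (expR S1) + 1.
have RmM : M < Rm by rewrite /Rm ltr_pwDr// le_max lexx.
have RmS : expR S1 < Rm by rewrite /Rm ltr_pwDr// le_max lexx orbT.
have f2Rm x : enorm x = Rm -> f2 x < f2 x0.
  move=> xR; have rx : r0 <= enorm x by rewrite xR ltW// (lt_trans rS1).
  apply: le_lt_trans (MP x _ rx); last by rewrite xR.
  rewrite /f2 ler_pM2r ?invr_gt0 ?w_gt0// profileE'// ler_expR; apply: lle.
  rewrite -ler_expR lnK ?posrE ?(lt_le_trans r0_gt0)// xR ltW//.
  exact: lt_trans RmS.
have cw x : r0 <= enorm x -> {for x, continuous (fun z => (w z)^-1)}.
  move=> rx; apply: (@continuousV R _ w x); first by rewrite gt_eqF// w_gt0.
  by have [] := wC2 x (lt_le_trans r1r0 rx).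
have cln x : r0 <= enorm x -> {for x, continuous (fun z : 'rV[R]_N => ln (enorm z))}.
  by move=> rx; apply: continuous_ln_enorm; exact: lt_le_trans rx.
have cexp x (h : R -> R) : r0 <= enorm x -> {for ln (enorm x), continuous h} ->
    {for x, continuous (fun z : 'rV[R]_N => h (ln (enorm z)))}.
  by move=> rx ch; apply: (@continuous_comp _ _ _ (fun z => ln (enorm z)) h) => //; exact: cln.
have [|x|x1 x1K x1max] := @annulus_max R N f1 r0 (expR S1) N0; first by rewrite ltW//= ltW.
  move=> /andP[rx _]; apply: continuousM; last exact: cw.
  apply: (cexp x (fun s => expR (a + kappa * s) * (s - s1))) => //.
  apply: cvgM; last by apply: cvgB; [exact: cvg_id | exact: cvg_cst].
  apply: (@continuous_comp _ _ _ (fun s => a + kappa * s) (@expR R)); last exact: continuous_expR.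
  by apply: cvgD; [exact: cvg_cst | apply: cvgM; [exact: cvg_cst | exact: cvg_id]].
have lnS x s : 0 < enorm x -> (expR s <= enorm x) = (s <= ln (enorm x)).
  by move=> xx; rewrite -[RHS]ler_expR lnK ?posrE.
have [|x|x2 x2K x2max] := @annulus_max R N f2 (expR S0) Rm N0.
- by rewrite expR_ge0 ltW// (lt_trans eS01).
- move=> /andP[Sx _]; have rx := le_trans (ltW rS0) Sx.
  apply: continuousM; last exact: cw.
  apply: (cexp x (fun s => expR (l s))) => //.
  apply: (@continuous_comp _ _ _ l (@expR R)); last exact: continuous_expR.
  have S0x : S0 <= ln (enorm x) by rewrite -lnS// (lt_le_trans r0_gt0).
  have [dl _] := dly _ (lt_le_trans SaS S0x).
  exact: is_derive_continuous dl.
have f2_gt0 : 0 < f2 x2.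
  by apply: lt_le_trans f2x0 (x2max _ _); rewrite x0E lexx ltW// (lt_trans eS01).
(* The larger maximum is interior. For [f1]: it vanishes on the inner sphere, and on the outer one
   it is below [f2]. For [f2]: on the inner sphere it is below [f1], and on the outer one below
   [f2 x0]. *)
have [f21|f12] := leP (f2 x2) (f1 x1).
  case/andP: x1K => rx1 x1S; have x10 := lt_le_trans r0_gt0 rx1.
  have s1x : s1 < ln (enorm x1).
    rewrite lt_neqAle ler_ln ?posrE// rx1 andbT; apply/eqP => e.
    by have := lt_le_trans f2_gt0 f21; rewrite /f1 -e subrr mulr0 mul0r ltxx.
  have rx1' : r0 < enorm x1 by rewrite -ltr_ln ?posrE.
  have x1S' : enorm x1 < expR S1.
    rewrite lt_neqAle x1S andbT; apply/eqP => e.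
    have lnx : ln (enorm x1) = S1 by rewrite e expRK.
    have : f1 x1 < f2 x1.
      rewrite f1E// /f2 ltr_pM2r ?invr_gt0 ?w_gt0// ltr_expR lnx /l1 -addrA.
      by have := gS; rewrite /a /g /l1; lra.
    rewrite ltNge => /negP; apply; apply: le_trans f21; apply: x2max.
    by rewrite e (ltW eS01) ltW.
  have : riccati p kappa eps (ln (enorm x1)) (kappa + (ln (enorm x1) - s1)^-1)
      (- (ln (enorm x1) - s1) ^- 2) <= 0.
    apply: (@interior_max_riccati R N p kappa eps r1 w x1 (l1 a) (fun s => kappa + (s - s1)^-1) _ p2 pk wC2).
    - exact: lt_trans rx1'.
    - exact: x10.
    - by near=> s; apply: dl1; near: s; exact: lt_nbhsr.
    - have sn : ln (enorm x1) - s1 != 0 by rewrite gt_eqF// subr_gt0.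
      have ds := is_deriveB (is_derive_id (ln (enorm x1)) 1) (is_derive_cst s1 (ln (enorm x1)) 1).
      have := is_deriveD (is_derive_cst kappa (ln (enorm x1)) 1)
        (@is_deriveV _ (fun s => s - s1) (ln (enorm x1)) _ 1 sn ds).
      by rewrite subr0 add0r [_%:A]mulr1.
    - by rewrite addr_gt0// invr_gt0 subr_gt0.
    - exact: near_w.
    - near=> z.
      have rz : r0 < enorm z by near: z; exact: near_lt_enorm.
      have zS : enorm z < expR S1 by near: z; exact: near_gt_enorm.
      have z0 := lt_trans r0_gt0 rz.
      rewrite -!f1E//; last by rewrite ltr_ln ?posrE.
      by apply: x1max; rewrite !ltW.
    - exact: super.
  have y1_gt0 : 0 < kappa + (ln (enorm x1) - s1)^-1 by rewrite addr_gt0// invr_gt0 subr_gt0.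
  (* For y = kappa + 1 / (s - s1) the sum y' + (y - kappa)^2 is exactly 0, against the strict
     inequality. *)
  move=> /(riccati_le0_sqr p2 kappa0 y1_gt0 eps0 (lt_trans s10 s1x)).
  by rewrite [kappa + _ - _]addrAC subrr add0r exprVn addNr ltxx.
case/andP: x2K => x2S x2R.
have rx2 : r0 < enorm x2 by exact: lt_le_trans x2S.
have x20 := lt_trans r0_gt0 rx2.
have x2S' : expR S0 < enorm x2.
  rewrite lt_neqAle x2S andbT; apply/eqP => e.
  have lnx : ln (enorm x2) = S0 by rewrite -e expRK.
  have : f2 x2 < f1 x2.
    rewrite f1E ?lnx// /f2 ltr_pM2r ?invr_gt0 ?w_gt0 ?(ltW rx2)// ltr_expR lnx /l1 -addrA.
    by have := gS; rewrite /a /g /l1; lra.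
  apply/negP; rewrite -leNgt; apply: le_trans (ltW f12); apply: x1max.
  by rewrite (ltW rx2) -e ltW.
have x2R' : enorm x2 < Rm.
  rewrite lt_neqAle x2R andbT; apply/eqP => /f2Rm; apply/negP; rewrite -leNgt.
  by apply: x2max; rewrite x0E lexx ltW// (lt_trans eS01).
have S0x : S0 < ln (enorm x2) by rewrite -ltr_expR lnK.
have [y_gt0 ric_gt0] := ric _ (ltW S0x).
have [_ dy] := dly _ (lt_trans SaS S0x).
suff : riccati p kappa eps (ln (enorm x2)) (y (ln (enorm x2))) (y1 (ln (enorm x2))) <= 0.
  by rewrite leNgt ric_gt0.
apply: (@interior_max_riccati R N p kappa eps r1 w x2 l y _ p2 pk wC2) => //.
- exact: lt_trans rx2.
- near=> s; have [] := dly s => //; apply: (lt_trans SaS); near: s; exact: lt_nbhsr.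
- exact: near_w.
- near=> z.
  have Sz : expR S0 < enorm z by near: z; exact: near_lt_enorm.
  have zR : enorm z < Rm by near: z; exact: near_gt_enorm.
  by apply: x2max; rewrite !ltW.
- exact: super.
Unshelve. all: by end_near. Qed.

End Main.

(** The quadratic is symmetric under b -> 2 / p - b, so reflected roots are roots again, which gives
    the sum; substitution gives the product. Positive sum and product force positive roots. *)
Lemma characteristic_roots (R : realType) (p q eps beta betabar : R) :
  0 < p -> 0 < q -> 0 < eps -> beta <= betabar ->
  (forall b : R, 2^-1 * q * (2 - b * p) * b = eps <-> b = beta \/ b = betabar) ->
  [/\ beta + betabar = 2 / p, beta * betabar = 2 / p * (eps / q) & 0 < beta].
Proof.
move=> p0 q0 eps0 bb roots; have pn : p != 0 by rewrite gt_eqF.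
have rb : 2^-1 * q * (2 - beta * p) * beta = eps by apply/roots; left.
have rbb : 2^-1 * q * (2 - betabar * p) * betabar = eps by apply/roots; right.
have sym b : 2^-1 * q * (2 - b * p) * b = eps -> 2 / p - b = beta \/ 2 / p - b = betabar.
  by move=> h; apply/roots; rewrite -[RHS]h; field.
have sumb : beta + betabar = 2 / p by case: (sym _ rb) (sym _ rbb) => h [] h'; lra.
have prodb : beta * betabar = 2 / p * (eps / q).
  have -> : betabar = 2 / p - beta by lra.
  by rewrite -rb; field; rewrite pn gt_eqF.
split => //; rewrite ltNge; apply/negP => b0.
have : 0 < beta * betabar by rewrite prodb mulr_gt0 ?divr_gt0.
have : 0 < beta + betabar by rewrite sumb divr_gt0.
move=> h; apply/negP; rewrite -leNgt mulr_le0_ge0//; lra.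
Qed.

Theorem theorem4p6 (R : realType) (N : nat) (p r0 eps beta betabar : R) :
  (2 <= N)%N -> 2 <= p -> N%:R < p -> expR 1 < r0 ->
  let CH := `|(p - N%:R) / p| `^ p in
  let Cstar := (p - 1) / (2 * p) * `|(p - N%:R) / p| `^ (p - 2) in
  0 < eps -> eps <= Cstar ->
  beta <= betabar ->
  (forall b : R,
     2^-1 * `|(p - N%:R) / p| `^ (p - 2) * (p - 1) * (2 - b * p) * b = eps
     <-> b = beta \/ b = betabar) ->
  (* (a) *)
  (forall v : 'rV[R]_N -> R,
     (forall x, r0 <= enorm x -> 0 < v x) ->
     radial_strictly_increasing r0 v ->
     C2_strict_supersolution p CH eps r0 v ->
     forall tau : R, tau < 0 ->
     exists C : R, 0 < C /\
       forall x, r0 <= enorm x -> profile p beta tau x <= C * v x)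
  /\
  (* (b) limsup_{|x|->oo} profile/w > 0 *)
  (forall w : 'rV[R]_N -> R,
     (forall x, r0 <= enorm x -> 0 < w x) ->
     C2_supersolution p CH eps r0 w ->
     forall tau : R,
     (eps < Cstar /\ 0 < tau) \/ (eps = Cstar /\ 2 / p < tau) ->
     exists c : R, 0 < c /\
       forall M : R, exists x, M < enorm x /\ r0 <= enorm x /\
         c <= profile p betabar tau x / w x).
Proof.
move=> N2 p2 Np r0e CH Cstar eps0 epsC bb roots.
have N0 : (0 < N)%N by exact: leq_trans N2.
have p0 : 0 < p by exact: lt_le_trans p2.
have pn : p != 0 by rewrite gt_eqF.
have kappa0 : 0 < (p - N%:R) / p by rewrite divr_gt0// subr_gt0.
have pk : p * ((p - N%:R) / p) = p - N%:R by rewrite mulrC divfK.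
move: roots; rewrite /Cstar /CH in epsC *; rewrite (gtr0_norm kappa0) in epsC *.
move: ((p - N%:R) / p) kappa0 pk epsC => kappa kappa0 pk epsC roots.
pose q := (p - 1) * kappa `^ (p - 2).
have q0 : 0 < q by rewrite mulr_gt0 ?powR_gt0// subr_gt0; lra.
have {}roots b : 2^-1 * q * (2 - b * p) * b = eps <-> b = beta \/ b = betabar.
  by rewrite -roots /q [(p - 1) * _]mulrC mulrA.
have [sumb prodb b0] := characteristic_roots p0 q0 eps0 bb roots.
(* The critical constant is the value of the quadratic at its vertex b = 1 / p. *)
have CE : (p - 1) / (2 * p) * kappa `^ (p - 2) = 2^-1 * q * (2 - p^-1 * p) * p^-1.
  by rewrite /q; field.
split=> [v v_gt0 v_incr [v2 v_super] tau tau0|w w_gt0 w_super tau cases].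
  apply: (radial_supersolution_growth N0 p2 kappa0 eps0 pk r0e b0 bb sumb prodb) => //.
  by split=> // x rx; exact/ltW/v_super.
apply: (supersolution_growth_limsup N0 p2 kappa0 eps0 pk r0e b0 bb sumb prodb) => //.
(* Since the roots sum to 2 / p, they coincide exactly when both are 1 / p, that is, when [eps] is
   the critical constant. *)
case: cases => [[eC tau0]|[eC tau2]]; [left | right]; split=> //.
  rewrite lt_neqAle bb andbT; apply/eqP => bE; move: eC; rewrite CE.
  have -> : p^-1 = beta by lra.
  by have /roots -> : beta = beta \/ beta = betabar by [left]; rewrite ltxx.
have : p^-1 = beta \/ p^-1 = betabar by apply/roots; rewrite eC CE.
by move=> [] h; lra.
Qed.
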